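(* Let $0<\alpha<1$. Then ${}^{\pm}H^{\alpha}(\mathbb{R})=\widetilde{H}^{\alpha}(\mathbb{R})$ for each choice of sign.
   Context: $\widetilde{H}^{\alpha}(\mathbb{R})=\Big\{u\in L^2(\mathbb{R}):\int_{\mathbb{R}}\int_{\mathbb{R}}\frac{|u(x)-u(y)|^2}{|x-y|^{1+2\alpha}}\,dx\,dy<\infty\Big\}$. Fractional integrals on $\mathbb{R}$, for $\sigma>0$: ${}^{-}I^{\sigma}f(x)=\frac{1}{\Gamma(\sigma)}\int_{-\infty}^x\frac{f(y)}{(x-y)^{1-\sigma}}\,dy$ and ${}^{+}I^{\sigma}f(x)=\frac{1}{\Gamma(\sigma)}\int_x^\infty\frac{f(y)}{(y-x)^{1-\sigma}}\,dy$. For $0<\alpha<1$: ${}^{-}D^{\alpha}\varphi=\frac{d}{dx}\,{}^{-}I^{1-\alpha}\varphi$ and ${}^{+}D^{\alpha}\varphi=-\frac{d}{dx}\,{}^{+}I^{1-\alpha}\varphi$. Weak fractional derivatives ($0<\alpha<1$): for $u\in L^2(\mathbb{R})$, $v\in L^1_{loc}(\mathbb{R})$ is the left (resp. right) weak fractional derivative of $u$, written ${}^{-}\mathcal{D}^{\alpha}u=v$ (resp. ${}^{+}\mathcal{D}^{\alpha}u=v$), if $\int_{\mathbb{R}} v\varphi\,dx=\int_{\mathbb{R}} u\,{}^{+}D^{\alpha}\varphi\,dx$ (resp. with ${}^{-}D^{\alpha}\varphi$ on the right-hand side) for all $\varphi\in C_0^\infty(\mathbb{R})$. ${}^{\pm}H^{\alpha}(\mathbb{R})={}^{\pm}W^{\alpha,2}(\mathbb{R})=\{u\in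 L^2(\mathbb{R}):{}^{\pm}\mathcal{D}^{\alpha}u\in L^2(\mathbb{R})\}$. The equality asserted is equality of sets of functions. *)

(* Defs.v *)
From mathcomp Require Import all_boot all_order all_algebra.
From mathcomp Require Import all_classical all_reals all_analysis.

Set Implicit Arguments.
Unset Strict Implicit.
Unset Printing Implicit Defensive.

Import Order.TTheory GRing.Theory Num.Theory.
Import numFieldNormedType.Exports.

Local Open Scope classical_set_scope.
Local Open Scope ring_scope.

Section FractionalSobolev.
Context {R : realType}.

Local Notation mu := (@lebesgue_measure R).

(* Functions are real valued and everywhere defined, with Borel measurable
   representatives; all the spaces below are sets of such functions. *)
Definition L2 : set (R -> R) := [set u | u \in Lfun mu 2%:E].

Definition Gamma (s : R) : R :=
  (\int[mu]_(t in `]0, +oo[) (t `^ (s - 1) * expR (- t)))%R.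

Definition left_fracint (sigma : R) (f : R -> R) (x : R) : R :=
  (Gamma sigma)^-1 *
  (\int[mu]_(y in `]-oo, x[) (f y / (x - y) `^ (1 - sigma)))%R.

Definition right_fracint (sigma : R) (f : R -> R) (x : R) : R :=
  (Gamma sigma)^-1 *
  (\int[mu]_(y in `]x, +oo[) (f y / (y - x) `^ (1 - sigma)))%R.

(* Only applied to test functions phi, for which the fractional integrals
   converge and are differentiable everywhere. *)
Definition left_fracderiv (alpha : R) (phi : R -> R) : R -> R :=
  derive1 (left_fracint (1 - alpha) phi).

Definition right_fracderiv (alpha : R) (phi : R -> R) : R -> R :=
  \- derive1 (right_fracint (1 - alpha) phi).

Definition test_function (phi : R -> R) : Prop :=
  (forall (n : nat) (x : R), derivable (derive1n n phi) x 1) /\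
  compact (closure [set x | phi x != 0]).

(* The left weak derivative is tested against the right derivative of phi,
   and conversely. *)
Definition is_left_weak_fracderiv (alpha : R) (u v : R -> R) : Prop :=
  locally_integrable setT v /\
  forall phi : R -> R, test_function phi ->
    (\int[mu]_x (v x * phi x))%R =
    (\int[mu]_x (u x * right_fracderiv alpha phi x))%R.

Definition is_right_weak_fracderiv (alpha : R) (u v : R -> R) : Prop :=
  locally_integrable setT v /\
  forall phi : R -> R, test_function phi ->
    (\int[mu]_x (v x * phi x))%R =
    (\int[mu]_x (u x * left_fracderiv alpha phi x))%R.

Definition left_H (alpha : R) : set (R -> R) :=
  [set u | L2 u /\ exists v, is_left_weak_fracderiv alpha u v /\ L2 v].

Definition right_H (alpha : R) : set (R -> R) :=
  [set u | L2 u /\ exists v, is_right_weak_fracderiv alpha u v /\ L2 v].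

(* The integrand is 0 on the diagonal (division by zero), a null set. *)
Definition tilde_H (alpha : R) : set (R -> R) :=
  [set u | L2 u /\
    (\int[mu]_y \int[mu]_x
       (`|u x - u y| ^+ 2 / `|x - y| `^ (1 + 2 * alpha))%:E < +oo)%E].

End FractionalSobolev.

(* Main.v *)
Require Import Defs.
From HB Require Import structures.
From mathcomp Require Import all_boot all_order all_algebra.
From mathcomp Require Import all_classical all_reals all_analysis.
From mathcomp Require Import measurable_realfun.
From mathcomp Require Import ring lra.

(* With W(r) = ||u - u(. - r)||^2, the Gagliardo integral equals
   int W(r) |r|^(-1-2 alpha) dr. For a bounded integrable kernel k >= 0 put
   D_k u (x) = int k(t) (u(x) - u(x - t)) dt. Then
   ||D_k u||^2 = 1/2 int W(r) kap_k(r) dr, where kap_k is even and, when k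
   lives on (0, oo), kap_k(r) = int k(t) (k(r) - k(t + r)) dt for r > 0.
   Reflecting k leaves kap_k unchanged, which is why left and right give the
   same space. If k is moreover nonincreasing on (0, oo), kap_k is nonnegative
   and superadditive in k. For k_e(t) = max(t, e)^(-1-alpha), kap is at most
   C |r|^(-1-2 alpha), and at least c |r|^(-1-2 alpha) when |r| >= e, so the
   Gagliardo integral is finite iff ||D_(k_e) u|| stays bounded as e -> 0.

   On a test function, D_(k_e) converges, uniformly and with a rate, to a
   positive multiple of the fractional derivative. If the Gagliardo integral is
   finite, superadditivity gives
   ||D_(k_d) u - D_(k_e) u||^2 <= ||D_(k_d) u||^2 - ||D_(k_e) u||^2 for d <= e,
   so D_(k_e) u is Cauchy, and its limit is a multiple of the weak derivative.
   Conversely, if v is a weak derivative of u, the norms of D_(k_e) applied to a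
   mollification of u increase as e -> 0, with limit at most a multiple of ||v||;
   Fatou's lemma along Lebesgue points removes the mollifier. *)

Set Implicit Arguments.
Unset Strict Implicit.
Unset Printing Implicit Defensive.

Import Order.TTheory GRing.Theory Num.Theory.
Import numFieldNormedType.Exports.

Local Open Scope classical_set_scope.
Local Open Scope ring_scope.

(** * Integration on the line *)

(** In Fourier variables everything would reduce to comparing symbols; here the norm identity comes
    from polarization and Fubini, and its weight [kap] carries the comparison. Since t^(-1-alpha) is
    not integrable at 0, the identity is used only for truncated kernels, and every bound has to be
    uniform in e.

    The link with the weak derivative exists only in pairings with a test function phi. Integrating
    by parts in t turns D_(k_e) phi into an integral of phi' against the tail of k_e, which differs
    from its limit only on (0, e]; the error is proportional to e^(1-alpha) and to the bound on
    phi'. When phi is a mollifying kernel this bound depends on the mollifier, so e has to tend to 0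
    while the mollifier stays fixed. Because the norms increase as e -> 0, the bound reached in the
    limit holds at every e, uniformly in the mollifier, and only then can the mollifier be
    removed. *)

Section RealIntegral.
Context {R : realType}.
Local Notation mu := (@lebesgue_measure R).
Implicit Types f g h k : R -> R.

Definition Ri f : R := (\int[mu]_x f x)%R.
Definition ib f : Prop := mu.-integrable setT (EFin \o f).

Lemma ibP f : ib f <-> mu.-integrable setT (EFin \o f).
Proof. by []. Qed.

Lemma RiE f : Ri f = (\int[mu]_x f x)%R.
Proof. by []. Qed.

Lemma ib_meas f : ib f -> measurable_fun setT f.
Proof. by move=> /integrableP[/measurable_EFinP]. Qed.

Lemma Ri_E f : ib f -> (\int[mu]_x (f x)%:E)%E = (Ri f)%:E.
Proof. by move=> h; rewrite /Ri /Rintegral fineK//; exact: integrable_fin_num. Qed.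

Lemma ge0_ib f : measurable_fun setT f -> (forall x, 0 <= f x) ->
  (\int[mu]_x (f x)%:E < +oo)%E -> ib f.
Proof.
move=> mf f0 h; apply/integrableP; split; first exact/measurable_EFinP.
by under eq_integral => x _ do rewrite /= ger0_norm//.
Qed.

Lemma ib_lty f : ib f -> (\int[mu]_x (f x)%:E < +oo)%E.
Proof. by move=> h; rewrite Ri_E// ltry. Qed.

Lemma ib_ext f g : f =1 g -> ib f -> ib g.
Proof. by move=> /funext ->. Qed.

Lemma eq_Ri f g : f =1 g -> Ri f = Ri g.
Proof. by move=> /funext ->. Qed.

Lemma ibD f g : ib f -> ib g -> ib (fun x => f x + g x).
Proof. by move=> hf hg; apply: (@integrableD _ _ _ mu setT _ (EFin \o f) (EFin \o g)). Qed.

Lemma ibB f g : ib f -> ib g -> ib (fun x => f x - g x).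
Proof. by move=> hf hg; apply: (@integrableB _ _ _ mu setT _ (EFin \o f) (EFin \o g)). Qed.

Lemma ibZ c f : ib f -> ib (fun x => c * f x).
Proof. by move=> hf; apply: (@integrableZl _ _ _ mu setT _ c (EFin \o f)). Qed.

Lemma Ri0 : Ri (fun=> 0) = 0.
Proof. by rewrite /Ri Rintegral_cst ?mul0r. Qed.

Lemma le_ib f g : measurable_fun setT f -> (forall x, `|f x| <= g x) ->
  ib g -> ib f.
Proof.
move=> mf fg; apply: le_integrable => //; first exact/measurable_EFinP.
by move=> x _ /=; rewrite lee_fin (le_trans (fg x))// ler_norm.
Qed.

Lemma ib_norm f : ib f -> ib (fun x => `|f x|).
Proof.
move=> h; apply: (@integrable_norm _ _ _ mu setT f h).
Qed.

Lemma ibM_bdd f g c : ib f -> measurable_fun setT g -> (forall x, `|g x| <= c) ->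
  ib (fun x => f x * g x).
Proof.
move=> hf mg gc; apply: (@le_ib _ (fun x => c * `|f x|)).
- by apply: measurable_funM => //; exact: ib_meas.
- by move=> x; rewrite normrM mulrC ler_wpM2r.
- by apply: ibZ; exact: ib_norm.
Qed.

Lemma RiD f g : ib f -> ib g -> Ri (fun x => f x + g x) = Ri f + Ri g.
Proof. exact: RintegralD. Qed.

Lemma RiB f g : ib f -> ib g -> Ri (fun x => f x - g x) = Ri f - Ri g.
Proof. exact: RintegralB. Qed.

Lemma RiZ c f : ib f -> Ri (fun x => c * f x) = c * Ri f.
Proof. exact: RintegralZl. Qed.

Lemma le_Ri f g : ib f -> ib g -> (forall x, f x <= g x) -> Ri f <= Ri g.
Proof. by move=> hf hg fg; apply: le_Rintegral. Qed.

Lemma Ri_ge0 f : (forall x, 0 <= f x) -> 0 <= Ri f.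
Proof. by move=> f0; apply: Rintegral_ge0. Qed.

Lemma Ri_norm f : ib f -> `|Ri f| <= Ri (fun x => `|f x|).
Proof. exact: le_normr_Rintegral. Qed.

Lemma ge0_le_ib f c : measurable_fun setT f -> (forall x, 0 <= f x) ->
  (\int[mu]_x (f x)%:E <= c%:E)%E -> ib f /\ Ri f <= c.
Proof.
move=> mf f0 h.
have hf : ib f by apply: ge0_ib => //; rewrite (le_lt_trans h)// ltry.
by split=> //; rewrite -lee_fin -Ri_E.
Qed.

(** * Translations and reflections of the line *)

Lemma measurable_affine (a s : R) : measurable_fun setT (fun x : R => a + s * x).
Proof. by apply: measurable_funD => //; apply: measurable_funM. Qed.

Lemma measurable_comp_affine f (a s : R) : measurable_fun setT f ->
  measurable_fun setT (fun x => f (a + s * x)).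
Proof. by move=> mf; apply: measurableT_comp => //; exact: measurable_affine. Qed.

(** Lebesgue measure is determined by its values on half-open intervals. For s = -1 the preimage of
    []b, c]] is half-open on the other side, with the same length. *)
Lemma lebesgue_measure_affine (a s : R) : s = 1 \/ s = -1 -> forall A, measurable A ->
  pushforward mu (fun x : measurableTypeR R => a + s * x : measurableTypeR R) A = mu A.
Proof.
move=> hs A mA.
have mphi : measurable_fun setT (fun x : measurableTypeR R => a + s * x : measurableTypeR R).
  exact: measurable_affine.
pose mm := isMeasurableFun.Build _ _ _ _ _ mphi.
pose phi : {mfun measurableTypeR R >-> measurableTypeR R} :=
  HB.pack (fun x : measurableTypeR R => a + s * x : measurableTypeR R) mm.
apply/esym/(@lebesgue_measure_unique R (pushforward mu phi)) => //= _ [[b c]] /= _ <-.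
rewrite /pushforward.
case: hs => hs.
- have -> : ((fun x : measurableTypeR R => a + s * x : measurableTypeR R) @^-1` `]b, c])
     = `]b - a, c - a]%classic.
    by apply/seteqP; split => x; rewrite /= !in_itv/= hs; lra.
  rewrite !lebesgue_measure_itv/= !lte_fin ltrD2r; case: ifP => // _.
  by congr EFin; lra.
- have -> : ((fun x : measurableTypeR R => a + s * x : measurableTypeR R) @^-1` `]b, c])
     = `[a - c, a - b[%classic.
    by apply/seteqP; split => x; rewrite /= !in_itv/= hs; lra.
  rewrite !lebesgue_measure_itv/= !lte_fin ltrD2l ltrN2; case: ifP => // _.
  by congr EFin; lra.
Qed.

Lemma ge0_integral_affine (F : R -> \bar R) (a s : R) : s = 1 \/ s = -1 ->
  measurable_fun setT F -> (forall x, 0 <= F x)%E ->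
  (\int[mu]_x F (a + s * x)%R = \int[mu]_x F x)%E.
Proof.
move=> hs mF F0.
have mphi : measurable_fun setT (fun x : measurableTypeR R => a + s * x : measurableTypeR R).
  exact: measurable_affine.
have E := @ge0_integral_pushforward _ _ _ _ R _ mphi mu setT F measurableT mF
  (fun x _ => F0 x).
rewrite preimage_setT in E; rewrite -[LHS]E.
by apply: eq_measure_integral => A mA _; exact: (lebesgue_measure_affine a hs mA).
Qed.

Lemma ib_affine f (a s : R) : s = 1 \/ s = -1 -> ib f -> ib (fun x => f (a + s * x)).
Proof.
move=> hs hf; have mf := ib_meas hf; apply/integrableP; split.
  by apply/measurable_EFinP; exact: (measurable_comp_affine a s mf).
move/integrableP: hf => [_]; apply: le_lt_trans.
rewrite (ge0_integral_affine a hs (F := fun x => `|(EFin \o f) x|%E))//.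
by apply: measurableT_comp => //; exact/measurable_EFinP.
Qed.

(** Positive and negative parts are transported separately, so measurability suffices and the
    identity also covers the default values of [Ri] at nonintegrable functions. *)
Lemma Ri_affine f (a s : R) : s = 1 \/ s = -1 -> measurable_fun setT f ->
  Ri (fun x => f (a + s * x)) = Ri f.
Proof.
move=> hs mf; rewrite /Ri /Rintegral; congr fine.
have mF : measurable_fun setT (EFin \o f) by exact/measurable_EFinP.
rewrite [LHS]integralE [RHS]integralE; congr (_ - _)%E.
- rewrite -(ge0_integral_affine a hs (measurable_funepos mF) (fun x => funepos_ge0 _ x)).
  by apply: eq_integral => x _; rewrite !funeposE.
- rewrite -(ge0_integral_affine a hs (measurable_funeneg mF) (fun x => funeneg_ge0 _ x)).
  by apply: eq_integral => x _; rewrite !funenegE.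
Qed.

Lemma ib_shift f (a : R) : ib f -> ib (fun x => f (x + a)).
Proof.
move=> hf; apply: ib_ext (ib_affine a (or_introl erefl) hf) => x.
by rewrite mul1r addrC.
Qed.

Lemma Ri_shift f (a : R) : measurable_fun setT f -> Ri (fun x => f (x + a)) = Ri f.
Proof.
move=> mf; rewrite -(Ri_affine a (or_introl erefl) mf).
by apply: eq_Ri => x; rewrite mul1r addrC.
Qed.

Lemma ib_refl f (a : R) : ib f -> ib (fun x => f (a - x)).
Proof.
move=> hf; apply: ib_ext (ib_affine a (or_intror erefl) hf) => x.
by rewrite mulN1r.
Qed.

Lemma Ri_refl f (a : R) : measurable_fun setT f -> Ri (fun x => f (a - x)) = Ri f.
Proof.
move=> mf; rewrite -(Ri_affine a (or_intror erefl) mf).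
by apply: eq_Ri => x; rewrite mulN1r.
Qed.

(** * Iterated integrals *)

Lemma measurable_Ri2 (F : R * R -> R) : measurable_fun setT F ->
  measurable_fun setT (fun x => Ri (fun y => F (x, y))).
Proof.
move=> mF; have mE : measurable_fun setT (EFin \o F) by exact/measurable_EFinP.
suff h : measurable_fun setT (fun x => \int[mu]_y (F (x, y))%:E)%E.
  exact: (measurableT_comp (fine_measurable measurableT) h).
under eq_fun do rewrite integralE.
apply: emeasurable_funB.
- apply: eq_measurable_fun (measurable_fun_fubini_tonelli_F (m2 := mu) _ (measurable_funepos mE) _) => // x _.
  by apply: eq_integral => y _; rewrite !funeposE.
- apply: eq_measurable_fun (measurable_fun_fubini_tonelli_F (m2 := mu) _ (measurable_funeneg mE) _) => // x _.
  by apply: eq_integral => y _; rewrite !funenegE.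
Qed.

Lemma measurable_flip2 (F : R * R -> R) : measurable_fun setT F ->
  measurable_fun setT (fun z => F (z.2, z.1)).
Proof. by move=> mF; apply: measurableT_comp => //; apply: measurable_fun_pair. Qed.

Lemma measurable_slice (F : R * R -> R) x : measurable_fun setT F ->
  measurable_fun setT (fun y => F (x, y)).
Proof. by move=> mF; apply: measurableT_comp. Qed.

Lemma ge0_Tonelli (F : R * R -> R) : measurable_fun setT F -> (forall z, 0 <= F z) ->
  (\int[mu]_x \int[mu]_y (F (x, y))%:E = \int[mu]_y \int[mu]_x (F (x, y))%:E)%E.
Proof.
move=> mF F0; have mE : measurable_fun setT (EFin \o F) by exact/measurable_EFinP.
have E0 z : (0 <= (EFin \o F) z)%E by rewrite lee_fin.
exact: (fubini_tonelli (m1 := mu) (m2 := mu) _ mE E0).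
Qed.

(* The inner integrals over y are required to be finite for every x; those
   over x are then finite only for almost every y. *)
Lemma Ri_Fubini (F : R * R -> R) (G : R -> R) : measurable_fun setT F -> ib G ->
  (forall x, ib (fun y => F (x, y)) /\ Ri (fun y => `|F (x, y)|) <= G x) ->
  [/\ ib (fun x => Ri (fun y => F (x, y))), ib (fun y => Ri (fun x => F (x, y))) &
    Ri (fun x => Ri (fun y => F (x, y))) = Ri (fun y => Ri (fun x => F (x, y)))].
Proof.
move=> mF hG hF.
have mE : measurable_fun setT (EFin \o F) by exact/measurable_EFinP.
have iF : (mu \x mu)%E.-integrable setT (EFin \o F).
  apply/integrable12ltyP => //; apply: le_lt_trans (ib_lty hG).
  apply: ge0_le_integral => //=.
  - by move=> x _; apply: integral_ge0.
  - have mN : measurable_fun setT (fun z => (`|F z|)%:E).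
      by apply/measurable_EFinP; exact: measurableT_comp.
    exact: (measurable_fun_fubini_tonelli_F (m2 := mu) _ mN).
  - by apply/measurable_EFinP; exact: ib_meas.
  - move=> x _; have [h1 h2] := hF x.
    by rewrite (Ri_E (ib_norm h1)) lee_fin.
have i1 : ib (fun x => Ri (fun y => F (x, y))).
  apply: eq_integrable (integrable_fubini_F iF) => // x _.
  by rewrite /fubini_F /= Ri_E//; exact: (hF x).1.
have m2 : measurable_fun setT (fun y => Ri (fun x => F (x, y))).
  exact: (measurable_Ri2 (measurable_flip2 mF)).
(* The extended integral over x may be infinite for a null set of y, where [Ri] takes the default
   value 0; elsewhere the two agree. *)
have ae2 : ae_eq mu setT (fubini_G mu (EFin \o F)) (EFin \o (fun y => Ri (fun x => F (x, y)))).
  apply: filterS (ae_integrable2 iF) => y h _.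
  by rewrite /fubini_G /= Ri_E.
have mG2 := measurable_fubini_G iF.
have i2 : ib (fun y => Ri (fun x => F (x, y))).
  have mS : measurable_fun setT (EFin \o (fun z : R * R => F (z.2, z.1))).
    by apply/measurable_EFinP; exact: measurable_flip2.
  have iS : (mu \x mu)%E.-integrable setT (EFin \o (fun z : R * R => F (z.2, z.1))).
    apply: (integrable21ltyP mu mu mS).2; exact: (integrable12ltyP mu mu mE).1 iF.
  have /integrableP[_ g2] := integrable_fubini_F iS.
  apply/integrableP; split; first exact/measurable_EFinP.
  apply: le_lt_trans g2; rewrite le_eqVlt; apply/orP; left; apply/eqP.
  apply: ae_eq_integral => //; first exact/measurableT_comp/measurable_EFinP.
    by apply: measurableT_comp => //; exact: mG2.
  by apply: filterS ae2 => y h _; have := h I; rewrite /fubini_G /fubini_F /= => ->.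
split=> [||]; [exact: i1|exact: i2|].
apply: EFin_inj; rewrite -(Ri_E i1) -(Ri_E i2).
transitivity (\int[mu]_y fubini_G mu (EFin \o F) y)%E; last first.
  by apply: ae_eq_integral => //; exact/measurable_EFinP.
rewrite -[RHS](Fubini iF); apply: eq_integral => x _.
by rewrite /= Ri_E//; exact: (hF x).1.
Qed.

(** * Cauchy-Schwarz inequalities by the discriminant *)

Lemma sqr_int_nneg_quadratic (a b c : R) : 0 <= a ->
  (forall t, 0 <= t ^+ 2 * a + 2 * t * b + c) -> b ^+ 2 <= a * c.
Proof.
move=> a0 h.
have [a_0|an0] := eqVneq a 0.
  suff -> : b = 0 by rewrite a_0 mul0r expr0n.
  apply/eqP; apply/negPn/negP => b0.
  (* With a = 0 the expression is affine in t, and this t sends it to -1. *)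
  have := h (- (c + 1) / (2 * b)); rewrite a_0.
  have -> : (- (c + 1) / (2 * b)) ^+ 2 * 0 + 2 * (- (c + 1) / (2 * b)) * b + c = -1.
    by field.
  by rewrite lerNr oppr0 ler10.
have ap : 0 < a by rewrite lt_neqAle eq_sym an0.
have := h (- b / a).
have -> : (- b / a) ^+ 2 * a + 2 * (- b / a) * b + c = (a * c - b ^+ 2) / a by field.
by rewrite pmulr_lge0 ?invr_gt0// subr_ge0.
Qed.

Lemma ib_mul f g : measurable_fun setT f -> measurable_fun setT g ->
  ib (fun x => f x ^+ 2) -> ib (fun x => g x ^+ 2) -> ib (fun x => f x * g x).
Proof.
move=> mf mg hf hg; apply: (@le_ib _ (fun x => f x ^+ 2 + g x ^+ 2)).
- exact: measurable_funM.
- move=> x; rewrite normrM.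
  have : 0 <= (`|f x| - `|g x|) ^+ 2 by exact: sqr_ge0.
  have : 0 <= (`|f x| + `|g x|) ^+ 2 by exact: sqr_ge0.
  rewrite -(real_normK (num_real (f x))) -(real_normK (num_real (g x))); lra.
- exact: ibD.
Qed.

Lemma Ri_Cauchy_Schwarz f g : measurable_fun setT f -> measurable_fun setT g ->
  ib (fun x => f x ^+ 2) -> ib (fun x => g x ^+ 2) ->
  (Ri (fun x => f x * g x)) ^+ 2 <= Ri (fun x => f x ^+ 2) * Ri (fun x => g x ^+ 2).
Proof.
move=> mf mg hf hg; have hfg := ib_mul mf mg hf hg.
apply: sqr_int_nneg_quadratic; first by apply: Ri_ge0 => x; exact: sqr_ge0.
move=> t.
have := @Ri_ge0 (fun x => t ^+ 2 * f x ^+ 2 + 2 * t * (f x * g x) + g x ^+ 2).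
have h1 : ib (fun x => t ^+ 2 * f x ^+ 2) by exact: ibZ.
have h2 : ib (fun x => 2 * t * (f x * g x)) by exact: ibZ.
rewrite RiD//; last exact: ibD.
rewrite RiD// !RiZ//.
apply=> x; have -> : t ^+ 2 * f x ^+ 2 + 2 * t * (f x * g x) + g x ^+ 2 = (t * f x + g x) ^+ 2 by ring.
exact: sqr_ge0.
Qed.

(** Cauchy-Schwarz for the measure k dx. Expanding the integral of k (t + f)^2 avoids the square
    root of k, and |k f| <= k + k f^2 supplies integrability. *)
Lemma Ri_weighted_sqr k f : ib k -> (forall x, 0 <= k x) -> measurable_fun setT f ->
  ib (fun x => k x * f x ^+ 2) ->
  ib (fun x => k x * f x) /\
  (Ri (fun x => k x * f x)) ^+ 2 <= Ri k * Ri (fun x => k x * f x ^+ 2).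
Proof.
move=> hk k0 mf hf.
have h1 : ib (fun x => k x * f x).
  apply: (@le_ib _ (fun x => k x + k x * f x ^+ 2)).
  - by apply: measurable_funM => //; exact: ib_meas.
  - move=> x; rewrite normrM ger0_norm// -[X in X + _]mulr1 -mulrDr ler_wpM2l//.
    have := normr_ge0 (f x).
    have : 0 <= (`|f x| - 1) ^+ 2 by exact: sqr_ge0.
    rewrite -(real_normK (num_real (f x))); lra.
  - exact: ibD.
split=> //; apply: sqr_int_nneg_quadratic; first exact: Ri_ge0.
move=> t.
have := @Ri_ge0 (fun x => t ^+ 2 * k x + 2 * t * (k x * f x) + k x * f x ^+ 2).
have h2 : ib (fun x => t ^+ 2 * k x) by exact: ibZ.
have h3 : ib (fun x => 2 * t * (k x * f x)) by exact: ibZ.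
rewrite RiD//; last exact: ibD.
rewrite RiD// !RiZ//.
apply=> x; have -> : t ^+ 2 * k x + 2 * t * (k x * f x) + k x * f x ^+ 2 = k x * (t + f x) ^+ 2 by ring.
by rewrite mulr_ge0// sqr_ge0.
Qed.

End RealIntegral.

(* Otherwise unification unfolds the integrals. *)
Opaque Ri ib.

(** * Truncated difference operators *)

Section Difference.
Context {R : realType}.
Implicit Types u g k : R -> R.

Definition sqint u : Prop := measurable_fun setT u /\ ib (fun x => u x ^+ 2).
Definition sqnorm u : R := Ri (fun x => u x ^+ 2).

Lemma sqnorm_ge0 u : 0 <= sqnorm u.
Proof. by apply: Ri_ge0 => x; exact: sqr_ge0. Qed.

Lemma sqint_mul u g : sqint u -> sqint g -> ib (fun x => u x * g x).
Proof. by move=> [mu_ hu] [mg hg]; exact: ib_mul. Qed.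

Lemma sqintZ c u : sqint u -> sqint (fun x => c * u x).
Proof.
move=> [mu_ hu]; split; first exact: measurable_funM.
by apply: ib_ext (ibZ (c ^+ 2) hu) => x; rewrite exprMn.
Qed.

Lemma sqintD u g : sqint u -> sqint g -> sqint (fun x => u x + g x).
Proof.
move=> hu hg; split; first by apply: measurable_funD; [exact: hu.1|exact: hg.1].
have := ibD (ibD hu.2 hg.2) (ibZ 2 (sqint_mul hu hg)).
by apply: ib_ext => x; ring.
Qed.

Lemma sqintB u g : sqint u -> sqint g -> sqint (fun x => u x - g x).
Proof.
move=> hu hg; split; first by apply: measurable_funB; [exact: hu.1|exact: hg.1].
have := ibB (ibD hu.2 hg.2) (ibZ 2 (sqint_mul hu hg)).
by apply: ib_ext => x; ring.
Qed.

Lemma sqnormZ c u : sqint u -> sqnorm (fun x => c * u x) = c ^+ 2 * sqnorm u.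
Proof.
move=> hu; rewrite /sqnorm -(RiZ _ hu.2).
by apply: eq_Ri => x; rewrite exprMn.
Qed.

Lemma sqnormD_le u g : sqint u -> sqint g -> sqnorm (fun x => u x + g x) <= 2 * sqnorm u + 2 * sqnorm g.
Proof.
move=> hu hg; rewrite /sqnorm -(RiZ _ hg.2) -(RiZ _ hu.2) -(RiD (ibZ 2 hu.2) (ibZ 2 hg.2)).
apply: le_Ri; first exact: (sqintD hu hg).2.
  by apply: ibD; apply: ibZ; [exact: hu.2|exact: hg.2].
by move=> x; have := sqr_ge0 (u x - g x); lra.
Qed.

Lemma sqnormB_le u g : sqint u -> sqint g -> sqnorm (fun x => u x - g x) <= 2 * sqnorm u + 2 * sqnorm g.
Proof.
move=> hu hg; have := sqnormD_le hu (sqintZ (-1) hg).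
rewrite sqnormZ// sqrrN expr1n mul1r.
by rewrite (_ : sqnorm _ = sqnorm (fun x => u x - g x))//; apply: eq_Ri => x; rewrite mulN1r.
Qed.

Lemma sqint_shift u a : sqint u -> sqint (fun x => u (x + a)).
Proof.
by move=> hu; split; [apply: (measurableT_comp hu.1); exact: measurable_funD|exact: (ib_shift a hu.2)].
Qed.

Lemma sqint_refl u a : sqint u -> sqint (fun x => u (a - x)).
Proof.
by move=> hu; split; [apply: (measurableT_comp hu.1); exact: measurable_funB|exact: (ib_refl a hu.2)].
Qed.

Lemma sqnorm_shift u a : sqint u -> sqnorm (fun x => u (x + a)) = sqnorm u.
Proof. by move=> hu; apply: (Ri_shift a (ib_meas hu.2)). Qed.

Lemma sqint_diff u t : sqint u -> sqint (fun x => u x - u (x - t)).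
Proof. by move=> hu; apply: sqintB => //; exact: sqint_shift. Qed.

Definition W u r : R := sqnorm (fun x => u x - u (x - r)).

Lemma W_ge0 u r : 0 <= W u r. Proof. exact: sqnorm_ge0. Qed.

Lemma W_le u r : sqint u -> W u r <= 4 * sqnorm u.
Proof.
move=> hu; apply: le_trans (sqnormB_le hu (sqint_shift (- r) hu)) _.
by rewrite sqnorm_shift//; lra.
Qed.

Lemma W0 u : W u 0 = 0.
Proof.
rewrite /W /sqnorm (@eq_Ri _ _ (fun=> 0)) ?Ri0//.
by move=> x; rewrite subr0 subrr expr0n.
Qed.

Lemma W_diff u s t : sqint u -> sqnorm (fun x => u (x - s) - u (x - t)) = W u (t - s).
Proof.
move=> hu; rewrite /W -(sqnorm_shift (- s) (sqint_diff (t - s) hu)); apply: eq_Ri => x.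
by congr ((u _ - u _) ^+ 2); ring.
Qed.

Lemma W_even u r : sqint u -> W u (- r) = W u r.
Proof.
move=> hu; rewrite -{1}(sub0r r) -W_diff// /W /sqnorm; apply: eq_Ri => x.
by rewrite subr0 -sqrrN opprB.
Qed.

Lemma measurable_diff2 u : measurable_fun setT u ->
  measurable_fun setT (fun z : R * R => u z.1 - u (z.1 - z.2)).
Proof.
move=> hu; apply: measurable_funB; first exact: measurableT_comp.
by apply: measurableT_comp => //; apply: measurable_funB.
Qed.

Lemma W_meas u : measurable_fun setT u -> measurable_fun setT (W u).
Proof.
move=> hu; apply: (measurable_Ri2 (F := fun z => (u z.2 - u (z.2 - z.1)) ^+ 2)).
apply: measurable_funX.
exact: (measurable_flip2 (measurable_diff2 hu)).
Qed.

(** Integrable and bounded, hence square integrable: the integral in [D k u x] then converges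
    absolutely at every x, not only at almost every x. *)
Definition kern k : Prop := [/\ ib k, forall t, 0 <= k t & exists B, forall t, k t <= B].

Lemma kern_sq k : kern k -> sqint k.
Proof.
move=> [hk k0 [B kB]]; split; first exact: ib_meas.
apply: ib_ext (ibM_bdd (c := B) hk (ib_meas hk) _) => x.
- by rewrite expr2.
- by rewrite ger0_norm.
Qed.

Lemma kern_refl k : kern k -> kern (fun t => k (- t)).
Proof.
move=> [hk k0 [B kB]]; split=> //; last by exists B.
by apply: ib_ext (ib_refl 0 hk) => x; rewrite sub0r.
Qed.

Lemma Ri_opp k : measurable_fun setT k -> Ri (fun t => k (- t)) = Ri k.
Proof.
by move=> hk; rewrite -(Ri_refl 0 hk); apply: eq_Ri => x; rewrite sub0r.
Qed.

Lemma kern_bdd_ib k (f : R -> R) (B : R) : kern k -> measurable_fun setT f -> (forall x, `|f x| <= B) ->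
  ib (fun x => k x * f x).
Proof. by move=> [hk _ _] mf fB; apply: ibM_bdd hk mf fB. Qed.

Lemma kern_ib_sqr k u : kern k -> sqint u -> ib (fun x => k x * u x ^+ 2).
Proof.
move=> [hk k0 [B kB]] [mu_ hu].
apply: ib_ext (ibM_bdd (c := B) hu (ib_meas hk) _) => x; first by rewrite mulrC.
by rewrite ger0_norm.
Qed.

(* Schur test for integral operators with kernel [k t], by Cauchy-Schwarz with weight [k]. *)
Lemma kern_L2 k (F : R * R -> R) (B : R) : kern k -> measurable_fun setT F ->
  (forall x, ib (fun t => k t * F (x, t) ^+ 2)) ->
  (forall t, ib (fun x => F (x, t) ^+ 2) /\ Ri (fun x => F (x, t) ^+ 2) <= B) ->
  sqint (fun x => Ri (fun t => k t * F (x, t))) /\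
  sqnorm (fun x => Ri (fun t => k t * F (x, t))) <= Ri k ^+ 2 * B.
Proof.
move=> [hk k0 kB] mF hx ht.
have mk := ib_meas hk.
have mkF : measurable_fun setT (fun z : R * R => k z.2 * F z).
  by apply: measurable_funM => //; exact: measurableT_comp.
have mH : measurable_fun setT (fun z : R * R => k z.1 * F (z.2, z.1) ^+ 2).
  apply: measurable_funM; first exact: measurableT_comp.
  by apply: measurable_funX; exact: measurable_flip2.
have B0 : 0 <= B by apply: le_trans (ht 0).2; apply: Ri_ge0 => x; exact: sqr_ge0.
have [t0|i1 i2 e] := @Ri_Fubini _ _ (fun t => B * k t) mH (ibZ B hk).
  split=> /=; first by apply: ibZ; exact: (ht t0).1.
  rewrite (@eq_Ri _ _ (fun x => k t0 * F (x, t0) ^+ 2)); last first.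
    by move=> x /=; rewrite ger0_norm// mulr_ge0// sqr_ge0.
  by rewrite (RiZ _ (ht t0).1) mulrC ler_wpM2r//; exact: (ht t0).2.
move: i1 i2 e => /= i1 i2 e.
have m1 : measurable_fun setT (fun x => Ri (fun t => k t * F (x, t))).
  exact: (measurable_Ri2 mkF).
have le1 x : Ri (fun t => k t * F (x, t)) ^+ 2 <= Ri k * Ri (fun t => k t * F (x, t) ^+ 2).
  by apply: (Ri_weighted_sqr hk k0 _ (hx x)).2; exact: measurable_slice.
have i3 : ib (fun x => Ri (fun t => k t * F (x, t)) ^+ 2).
  apply: le_ib (ibZ (Ri k) i2); first exact: measurable_funX.
  by move=> x; rewrite ger0_norm ?sqr_ge0.
split; first by split.
apply: le_trans (le_Ri i3 (ibZ (Ri k) i2) le1) _.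
rewrite (RiZ _ i2) -e expr2 -mulrA ler_wpM2l ?Ri_ge0// mulrC -(RiZ B hk).
apply: le_Ri; [exact: i1|exact: ibZ|] => t /=.
by rewrite (RiZ _ (ht t).1) mulrC ler_wpM2r//; exact: (ht t).2.
Qed.

Definition D k u x : R := Ri (fun t => k t * (u x - u (x - t))).

Lemma ib_D k u x : kern k -> sqint u -> ib (fun t => k t * (u x - u (x - t))).
Proof.
move=> hk hu.
have h1 : ib (fun t => k t * u (x - t)) by apply: sqint_mul; [exact: kern_sq|exact: sqint_refl].
have h2 : ib k by case: hk.
apply: ib_ext (ibB (ibZ (u x) h2) h1) => t; ring.
Qed.

Lemma D_L2 k u : kern k -> sqint u -> sqint (D k u).
Proof.
move=> hk hu.
apply: (kern_L2 (B := 4 * sqnorm u) hk (measurable_diff2 hu.1) _ _).1 => [x|t] /=.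
- have h1 := kern_ib_sqr hk (sqint_refl x hu).
  have h2 : ib (fun t => k t * u (x - t)) by apply: sqint_mul; [exact: kern_sq|exact: sqint_refl].
  have h3 : ib k by case: hk.
  apply: ib_ext (ibD (ibB (ibZ (u x ^+ 2) h3) (ibZ (2 * u x) h2)) h1) => t; ring.
- by split; [exact: (sqint_diff t hu).2|exact: W_le].
Qed.

(** Fubini, the integrand being dominated through |a b| <= a^2 + b^2 and [W_le]. Adjointness, the
    norm formula and the commutation with convolution are all read off this form. *)
Lemma D_pair k u g : kern k -> sqint u -> sqint g ->
  ib (fun t => k t * Ri (fun x => (u x - u (x - t)) * g x)) /\
  Ri (fun x => D k u x * g x) = Ri (fun t => k t * Ri (fun x => (u x - u (x - t)) * g x)).
Proof.
move=> hk hu hg; have [ik k0 _] := hk.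
have mH : measurable_fun setT (fun z : R * R => k z.1 * ((u z.2 - u (z.2 - z.1)) * g z.2)).
  apply: measurable_funM; first by apply: measurableT_comp => //; exact: ib_meas.
  apply: measurable_funM; first exact: (measurable_flip2 (measurable_diff2 hu.1)).
  by apply: measurableT_comp => //; exact: hg.1.
have [t|i1 i2 e] := @Ri_Fubini _ _ (fun t => (4 * sqnorm u + sqnorm g) * k t) mH (ibZ _ ik).
  have h := sqint_mul (sqint_diff t hu) hg; split=> /=; first exact: ibZ.
  rewrite (@eq_Ri _ _ (fun x => k t * `|(u x - u (x - t)) * g x|)); last first.
    by move=> x /=; rewrite normrM ger0_norm.
  rewrite (RiZ _ (ib_norm h)).
  rewrite mulrC ler_wpM2r//.
  apply: (@le_trans _ _ (W u t + sqnorm g)); last by rewrite lerD2r; exact: W_le.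
  rewrite /W /sqnorm -(RiD (sqint_diff t hu).2 hg.2).
  apply: le_Ri; first exact: ib_norm.
    by apply: ibD; [exact: (sqint_diff t hu).2|exact: hg.2].
  move=> x; rewrite normrM; set a := u x - _; set b := g x.
  have := sqr_ge0 (`|a| - `|b|); have := sqr_ge0 (`|a| + `|b|).
  rewrite -(real_normK (num_real a)) -(real_normK (num_real b)); lra.
have E t : Ri (fun x => k t * ((u x - u (x - t)) * g x)) = k t * Ri (fun x => (u x - u (x - t)) * g x).
  by rewrite (RiZ _ (sqint_mul (sqint_diff t hu) hg)).
move: i1 e => /= i1 e; split; first exact: (ib_ext E i1).
rewrite -(eq_Ri E) e; apply: eq_Ri => x.
rewrite /D mulrC -(RiZ _ (ib_D x hk hu)).
by apply: eq_Ri => t; ring.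
Qed.

(** The adjoint of the translation by t is the translation by -t, so passing to the adjoint reflects
    the kernel. *)
Lemma D_adjoint k u g : kern k -> sqint u -> sqint g ->
  Ri (fun x => D k u x * g x) = Ri (fun x => u x * D (fun t => k (- t)) g x).
Proof.
move=> hk hu hg; have hk' := kern_refl hk.
have -> : Ri (fun x => u x * D (fun t => k (- t)) g x) = Ri (fun x => D (fun t => k (- t)) g x * u x).
  by apply: eq_Ri => x; rewrite mulrC.
have [i1 ->] := D_pair hk hu hg; have [i2 ->] := D_pair hk' hg hu.
rewrite -[RHS](Ri_opp (ib_meas i2)); apply: eq_Ri => t; rewrite opprK; congr (_ * _).
have h0 := sqint_mul hu hg.
have h1 := sqint_mul (sqint_shift (- t) hu) hg.
have h2 := sqint_mul (sqint_shift t hg) hu.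
rewrite (@eq_Ri _ _ (fun x => u x * g x - u (x - t) * g x)); last by move=> x; ring.
rewrite (RiB h0 h1) [RHS](@eq_Ri _ _ (fun x => u x * g x - g (x + t) * u x)); last first.
  by move=> x; ring.
rewrite (RiB h0 h2); congr (_ - _).
rewrite -(Ri_shift t (ib_meas h1)); apply: eq_Ri => x.
by rewrite addrK mulrC.
Qed.

(** * The squared norm of [D k u] as an integral of [W u] *)

Definition autoc k r : R := Ri (fun t => k t * k (t + r)).
(** With K the integral of k and k^ its Fourier transform, [kap k] has transform 2 K Re k^ - |k^|^2,
    and K^2 minus this is |K - k^|^2, the squared modulus of the symbol of [D k]. *)
Definition kap k r : R := Ri k * (k r + k (- r)) - autoc k r.

Lemma ib_autoc k r : kern k -> ib (fun t => k t * k (t + r)).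
Proof. by move=> hk; have h := kern_sq hk; apply: sqint_mul => //; exact: sqint_shift. Qed.

Lemma autoc_even k r : kern k -> autoc k (- r) = autoc k r.
Proof.
move=> hk; rewrite /autoc -(Ri_shift r (ib_meas (ib_autoc (- r) hk))).
by apply: eq_Ri => t; rewrite addrK mulrC.
Qed.

Lemma kap_even k r : kern k -> kap k (- r) = kap k r.
Proof. by move=> hk; rewrite /kap autoc_even// opprK (addrC (k r)). Qed.

Lemma kap_refl k r : kern k -> kap (fun t => k (- t)) r = kap k r.
Proof.
move=> hk; rewrite /kap Ri_opp; last by case: hk => /ib_meas.
rewrite opprK (addrC (k r)); congr (_ - _).
rewrite -(autoc_even r hk) /autoc -[LHS](Ri_refl 0 (ib_meas (ib_autoc r (kern_refl hk)))).
by apply: eq_Ri => t; congr (k _ * k _); ring.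
Qed.

Lemma W_bdd u r : sqint u -> `|W u r| <= 4 * sqnorm u.
Proof. by move=> hu; rewrite ger0_norm ?W_ge0//; exact: W_le. Qed.

(** Polarization: the two differences subtract to u(. - t) - u(. - s), whose squared norm is
    [W u (t - s)]. *)
Lemma diff_pair u s t : sqint u ->
  Ri (fun x => (u x - u (x - s)) * (u x - u (x - t))) = 2^-1 * (W u s + W u t - W u (t - s)).
Proof.
move=> hu; rewrite -(W_diff s t hu) /W /sqnorm.
have hs := sqint_diff s hu; have ht := sqint_diff t hu.
have hst : sqint (fun x => u (x - s) - u (x - t)) by apply: sqintB; exact: sqint_shift.
have hD := ibD hs.2 ht.2.
rewrite -(RiD hs.2 ht.2) -(RiB hD hst.2) -(RiZ _ (ibB hD hst.2)).
by apply: eq_Ri => x; field.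
Qed.

Lemma ib_autoc_fun k : kern k -> ib (autoc k).
Proof.
move=> hk; have [ik k0 [B kB]] := hk; have mk := ib_meas ik.
have mH : measurable_fun setT (fun z : R * R => k z.1 * k (z.1 + z.2)).
  apply: measurable_funM; first exact: measurableT_comp.
  by apply: measurableT_comp => //; exact: measurable_funD.
have [t|i1 i2 e] := @Ri_Fubini _ _ (fun t => Ri k * k t) mH (ibZ _ ik); last exact: i2.
have h : ib (fun r => k (t + r)) by apply: ib_ext (ib_shift t ik) => r; rewrite addrC.
split=> /=; first by apply: ibZ.
rewrite (@eq_Ri _ _ (fun r => k t * k (t + r))); last first.
  by move=> r /=; rewrite ger0_norm// mulr_ge0.
rewrite (RiZ _ h) mulrC ler_wpM2r// -(Ri_shift t mk) le_eqVlt; apply/orP; left; apply/eqP.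
by apply: eq_Ri => r; rewrite addrC.
Qed.

Lemma ib_W_kap k u : kern k -> sqint u -> ib (fun r => W u r * kap k r).
Proof.
move=> hk hu; have [ik k0 [B kB]] := hk.
have h : ib (kap k).
  apply: ibB; last exact: ib_autoc_fun.
  apply: ibZ; apply: ibD => //.
  by apply: ib_ext (ib_refl 0 ik) => r; rewrite sub0r.
apply: ib_ext (ibM_bdd (c := 4 * sqnorm u) h (W_meas hu.1) _) => r; first by rewrite mulrC.
exact: W_bdd.
Qed.

(** Pairing [D k u] with itself and polarizing gives half the double integral of k(s) k(t) (W(s) +
    W(t) - W(t - s)). The first two terms each contribute K times the integral of k W; in the third,
    the variable r = s - t brings out the autocorrelation. *)
Lemma D_norm k u : kern k -> sqint u -> sqnorm (D k u) = 2^-1 * Ri (fun r => W u r * kap k r).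
Proof.
move=> hk hu; have [ik k0 [B kB]] := hk; have mk := ib_meas ik.
have hD := D_L2 hk hu.
set K := Ri k; pose A := Ri (fun t => k t * W u t).
have mW := W_meas hu.1.
have ikW : ib (fun t => k t * W u t) by apply: (kern_bdd_ib hk mW) => r; exact: W_bdd.
pose E t := Ri (fun s => k s * W u (t - s)).
have iE t : ib (fun s => k s * W u (t - s)).
  apply: (@kern_bdd_ib _ _ (4 * sqnorm u) hk) => [|s]; last exact: W_bdd.
  by apply: (measurableT_comp mW); exact: measurable_funB.
have E1 t : Ri (fun x => (u x - u (x - t)) * D k u x) = 2^-1 * (A + K * W u t - E t).
  rewrite (@eq_Ri _ _ (fun x => D k u x * (u x - u (x - t)))); last by move=> x; rewrite mulrC.
  have [i1 ->] := D_pair hk hu (sqint_diff t hu).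
  rewrite (@eq_Ri _ _ (fun s => 2^-1 * (k s * W u s + W u t * k s - k s * W u (t - s)))); last first.
    by move=> s; rewrite diff_pair//; ring.
  have h1 : ib (fun s => W u t * k s) by exact: ibZ.
  have h2 : ib (fun s => k s * W u s + W u t * k s) by exact: ibD.
  by rewrite (RiZ _ (ibB h2 (iE t))) (RiB h2 (iE t)) (RiD ikW h1) (RiZ _ ik) (mulrC (W u t)).
have [_ e] := D_pair hk hu hD.
have -> : sqnorm (D k u) = Ri (fun x => D k u x * D k u x).
  by apply: eq_Ri => x; rewrite expr2.
rewrite {}e.
have mH : measurable_fun setT (fun z : R * R => k z.1 * (k (z.1 + z.2) * W u z.2)).
  apply: measurable_funM; first exact: measurableT_comp.
  apply: measurable_funM; last exact: measurableT_comp.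
  by apply: measurableT_comp => //; exact: measurable_funD.
have ish t : ib (fun r => k (t + r)).
  by apply: ib_ext (ib_shift t ik) => r; rewrite addrC.
have iW t : ib (fun r => k (t + r) * W u r).
  by apply: (ibM_bdd (c := 4 * sqnorm u)) => // r; exact: W_bdd.
have [t|i1 i2 e] := @Ri_Fubini _ _ (fun t => (Ri k * (4 * sqnorm u)) * k t) mH (ibZ _ ik).
  split=> /=; first exact: ibZ.
  rewrite (@eq_Ri _ _ (fun r => k t * (k (t + r) * W u r))); last first.
    by move=> r /=; rewrite ger0_norm// !mulr_ge0// W_ge0.
  rewrite (RiZ _ (iW t)) mulrC ler_wpM2r//.
  rewrite (_ : Ri k * _ = Ri (fun r => 4 * sqnorm u * k (t + r))); last first.
    rewrite (RiZ _ (ish t)) mulrC -(Ri_shift t mk); congr (_ * _).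
    by apply: eq_Ri => r; rewrite addrC.
  apply: le_Ri => //; first exact: ibZ.
  by move=> r; rewrite mulrC ler_wpM2r//; exact: W_le.
move: i1 i2 e => /= i1 i2 e.
have E2 t : E t = Ri (fun r => k (t + r) * W u r).
  rewrite /E -(Ri_shift t (ib_meas (iE t))); apply: eq_Ri => r.
  by rewrite -(W_even _ hu); congr (k _ * W u _); ring.
have E3 t : Ri (fun r => k t * (k (t + r) * W u r)) = k t * E t.
  by rewrite (RiZ _ (iW t)) E2.
have ikE : ib (fun t => k t * E t) by exact: (ib_ext E3 i1).
have ee : Ri (fun t => k t * E t) = Ri (fun r => W u r * autoc k r).
  rewrite -(eq_Ri E3) e; apply: eq_Ri => r; rewrite /autoc -(RiZ _ (ib_autoc r hk)).
  by apply: eq_Ri => t; ring.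
rewrite (@eq_Ri _ _ (fun t => 2^-1 * (A * k t + K * (k t * W u t) - k t * E t))); last first.
  by move=> t; rewrite E1; ring.
have hA : ib (fun t => A * k t) by exact: ibZ.
have hK : ib (fun t => K * (k t * W u t)) by exact: ibZ.
have hAK := ibD hA hK.
rewrite (RiZ _ (ibB hAK ikE)) (RiB hAK ikE) (RiD hA hK) (RiZ _ ik) (RiZ _ ikW) ee -/K -/A; congr (_ * _).
have ikW' : ib (fun t => k (- t) * W u t).
  by apply: (kern_bdd_ib (kern_refl hk) mW) => r; exact: W_bdd.
(* Evenness of W moves one of the two equal contributions onto the reflected kernel, whence the term
   k(-r) in [kap]. *)
have A' : A = Ri (fun t => k (- t) * W u t).
  rewrite /A -(Ri_opp (ib_meas ikW)); apply: eq_Ri => t; by rewrite W_even.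
have iWa : ib (fun r => W u r * autoc k r).
  apply: ib_ext (ibM_bdd (c := 4 * sqnorm u) (ib_autoc_fun hk) mW _) => r; first by rewrite mulrC.
  exact: W_bdd.
have hs := ibD ikW ikW'.
rewrite [RHS](@eq_Ri _ _ (fun r => K * (k r * W u r + k (- r) * W u r) - W u r * autoc k r)); last first.
  by move=> r; rewrite /kap -/K; ring.
by rewrite (RiB (ibZ K hs) iWa) (RiZ _ hs) (RiD ikW ikW') -A' -/A; ring.
Qed.

Lemma D_norm_refl k u : kern k -> sqint u -> sqnorm (D (fun t => k (- t)) u) = sqnorm (D k u).
Proof.
move=> hk hu; rewrite (D_norm hk hu) (D_norm (kern_refl hk) hu); congr (_ * _).
by apply: eq_Ri => r; rewrite (kap_refl r hk).
Qed.

End Difference.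

(** * Integrals of powers over half-lines *)

Section Powers.
Context {R : realType}.
Local Notation mu := (@lebesgue_measure R).

Lemma Ri_itv (i : interval R) (f : R -> R) :
  Ri (fun t => if t \in i then f t else 0) = (\int[mu]_(t in [set` i]) f t)%R.
Proof.
rewrite Rintegral_mkcond; congr (Rintegral _ _ _); apply/funext => t.
by rewrite patchE mem_setE.
Qed.

Lemma ib_itv (i : interval R) (f : R -> R) :
  ib (fun t => if t \in i then f t else 0) <-> mu.-integrable [set` i] (EFin \o f).
Proof.
have -> : ib (fun t => if t \in i then f t else 0) <->
    mu.-integrable setT (((EFin \o f) \_ [set` i]) : R -> \bar R).
  have -> : (((EFin \o f) \_ [set` i]) : R -> \bar R) =
    EFin \o (fun t => if t \in i then f t else 0); last by [].
  by apply/funext => t; rewrite /= patchE mem_setE; case: ifP.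
split; first by move=> h; apply/(integrable_mkcond _ _).2.
by move=> h; apply/(integrable_mkcond _ _).1.
Qed.

Lemma ge0_integral_itv (i : interval R) (f : R -> R) :
  (\int[mu]_t (if t \in i then f t else 0)%:E = \int[mu]_(t in [set` i]) (f t)%:E)%E.
Proof.
rewrite [RHS]integral_mkcond; apply: eq_integral => t _; rewrite patchE mem_setE.
by case: ifP.
Qed.

Lemma ib_itv_cst (a b c : R) (b0 b1 : bool) :
  ib (fun t => if t \in Interval (BSide b0 a) (BSide b1 b) then c else 0).
Proof.
have h := @integrable_indic_itv R a b b0 b1.
apply: ib_ext (ibZ c h) => t; rewrite indicE mem_setE.
by case: ifP => _; rewrite ?mulr1 ?mulr0.
Qed.

Lemma Ri_itv_cst (a b c : R) (b0 b1 : bool) : a < b ->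
  Ri (fun t => if t \in Interval (BSide b0 a) (BSide b1 b) then c else 0) = c * (b - a).
Proof.
move=> ab; rewrite (Ri_itv _ (fun=> c)) Rintegral_cst//.
by rewrite /= lebesgue_measure_itv /= lte_fin ab.
Qed.

Lemma measurable_itv_if (i : interval R) (f : R -> R) : measurable_fun setT f ->
  measurable_fun setT (fun t => if t \in i then f t else 0).
Proof.
move=> mf; have -> : (fun t => if t \in i then f t else 0) = f \_ [set` i].
  by apply/funext => t; rewrite patchE mem_setE.
by apply/(measurable_restrictT f); [exact: measurable_itv|exact: measurable_funTS].
Qed.

Lemma is_derive_powR (b x : R) : 0 < x -> b != 0 ->
  is_derive x 1 (fun t : R => t `^ b / b) (x `^ (b - 1)).
Proof.
move=> x0 b0; have h := is_deriveZ (b^-1) (is_derive1_powR b x0).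
have -> : (fun t : R => t `^ b / b) = b^-1 \*: (fun t : R => t `^ b).
  by apply/funext => t; rewrite /= mulrC.
by apply: (is_derive_eq h); rewrite /GRing.scale/= mulrA mulVf// mul1r.
Qed.

Lemma derivable_continuous (f : R -> R) (x : R) : derivable f x 1 -> {for x, continuous f}.
Proof. by move=> h; apply: differentiable_continuous; apply/derivable1_diffP. Qed.

Lemma powRN_cvg0 (a : R) : 0 < a -> t `^ (- a) @[t --> +oo] --> 0.
Proof.
move=> a0; apply/cvgrPdist_le => e e0; near=> t.
have t0 : 0 < t by near: t; apply: nbhs_pinfty_gt; exact: num_real.
rewrite sub0r normrN ger0_norm ?powR_ge0// powRN invf_ple ?posrE ?powR_gt0//.
have -> : e^-1 = ((e^-1) `^ a^-1) `^ a.
  by rewrite -powRrM mulVf ?gt_eqF// powRr1// invr_ge0 ltW.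
apply: ge0_ler_powR; [exact: ltW|by rewrite nnegrE powR_ge0|by rewrite nnegrE ltW|].
by near: t; apply: nbhs_pinfty_ge; exact: num_real.
Unshelve. all: by end_near. Qed.

Lemma Ri_tail_powR (a s : R) : 0 < a -> 0 < s ->
  ib (fun t => if t \in `]s, +oo[ then t `^ (- a - 1) else 0) /\
  Ri (fun t => if t \in `]s, +oo[ then t `^ (- a - 1) else 0) = s `^ (- a) / a.
Proof.
move=> a0 s0; have Na0 : - a != 0 by rewrite oppr_eq0 gt_eqF.
have dF (x : R) : 0 < x -> is_derive x 1 (fun t : R => t `^ (- a) / (- a)) (x `^ (- a - 1)).
  by move=> x0; apply: is_derive_powR.
have mp : measurable_fun setT (fun t : R => t `^ (- a - 1)) by exact: measurable_powR.
have e : (\int[mu]_t (if t \in `]s, +oo[ then t `^ (- a - 1) else 0)%:E = (s `^ (- a) / a)%:E)%E.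
  rewrite ge0_integral_itv integral_itv_obnd_cbnd; last first.
    by apply/measurable_EFinP; exact: measurable_funTS.
  rewrite (@ge0_continuous_FTC2y _ _ (fun t => t `^ (- a) / (- a)) _ 0).
  - by rewrite -EFinB sub0r invrN mulrN opprK.
  - by move=> x _; exact: powR_ge0.
  - apply: derivable_within_continuous => x; rewrite in_itv/= andbT => sx.
    by apply: derivable_powR; rewrite in_itv/= andbT (lt_le_trans s0).
  - by rewrite -(mul0r (- a)^-1); apply: cvgMl; exact: powRN_cvg0.
  - by move=> x sx; have [] := dF x (lt_trans s0 sx).
  - have [dFs _] := dF s s0; have cF := derivable_continuous dFs.
    exact: (cvg_at_right_filter cF).
  - move=> x; rewrite in_itv/= andbT => sx.
    by rewrite derive1E; have [_ ->] := dF x (lt_trans s0 sx).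
have hi : ib (fun t => if t \in `]s, +oo[ then t `^ (- a - 1) else 0).
  apply: ge0_ib; [exact: measurable_itv_if| |by rewrite e ltry].
  by move=> x; case: ifP => // _; exact: powR_ge0.
by split=> //; apply: EFin_inj; rewrite -(Ri_E hi) e.
Qed.

(** The antiderivative t^b / b is used only on [1/(n+1), a], away from the possible singularity at
    0. Its value at the lower end is dropped, which leaves a bound independent of n, and monotone
    convergence carries it to []0, a]]. *)
Lemma Ri_head_powR (b a : R) : 0 < b -> 0 < a ->
  ib (fun t => if t \in `]0, a] then t `^ (b - 1) else 0) /\
  Ri (fun t => if t \in `]0, a] then t `^ (b - 1) else 0) <= a `^ b / b.
Proof.
move=> b0 a0; have bn0 : b != 0 by rewrite gt_eqF.
have mp : measurable_fun setT (fun t : R => t `^ (b - 1)) by exact: measurable_powR.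
apply: ge0_le_ib; [exact: measurable_itv_if| |].
  by move=> x; case: ifP => // _; exact: powR_ge0.
rewrite ge0_integral_itv.
pose F (n : nat) := `[n.+1%:R^-1, a]%classic : set R.
have -> : `]0, a]%classic = \bigcup_n F n.
  apply/seteqP; split=> [x /=|x [n _]].
  - rewrite in_itv/= => /andP[x0 xa]; have [n _ hn] := near_infty_natSinv_lt (PosNum x0).
    exists n => //; rewrite /F /= in_itv/= xa andbT ltW//.
    exact: (hn n (leqnn n)).
  - rewrite /F /= !in_itv /= => /andP[h xa]; rewrite xa andbT (lt_le_trans _ h)//.
have c : (\int[mu]_(x in F i) (x `^ (b - 1))%:E)%E @[i --> \oo] -->
    (\int[mu]_(x in \bigcup_i F i) (x `^ (b - 1))%:E)%E.
  apply: ge0_nondecreasing_set_cvg_integral => //.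
  - apply/nondecreasing_seqP => n; apply/subsetPset => x; rewrite /F /= !in_itv/= => /andP[h xa].
    by rewrite xa andbT (le_trans _ h)// lef_pV2 ?posrE// ler_nat.
  - by move=> n; rewrite /F; exact: measurable_itv.
  - by move=> n; apply/measurable_EFinP; exact: measurable_funTS.
  - by move=> n x _; rewrite lee_fin powR_ge0.
have B0 : 0 <= a `^ b / b by rewrite divr_ge0 ?powR_ge0// ltW.
rewrite -(cvg_lim _ c)//; apply: lime_le; first by apply/cvg_ex; eexists; exact: c.
apply: nearW => n; rewrite /F.
have n0 : 0 < n.+1%:R^-1 :> R by rewrite invr_gt0.
(* For small n the interval is empty or a single point. *)
have [an|na] := leP a n.+1%:R^-1.
  move: an; rewrite le_eqVlt => /predU1P[<-|an].
    by rewrite set_itv1 integral_set1 lee_fin.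
  rewrite set_itv_ge ?integral_set0 ?lee_fin// bnd_simp -ltNge//.
have dF (x : R) : 0 < x -> is_derive x 1 (fun t : R => t `^ b / b) (x `^ (b - 1)).
  by move=> x0; apply: is_derive_powR.
have cF (x : R) : 0 < x -> {for x, continuous (fun t => t `^ b / b)}.
  by move=> x0; apply: derivable_continuous; have [] := dF x x0.
rewrite (@continuous_FTC2 _ _ (fun t => t `^ b / b) _ _ na).
- by rewrite -EFinB lee_fin lerBlDr lerDl divr_ge0 ?powR_ge0// ltW.
- apply: derivable_within_continuous => x; rewrite in_itv/= => /andP[h _].
  by apply: derivable_powR; rewrite in_itv/= andbT (lt_le_trans n0).
- split.
  + by move=> x; rewrite in_itv/= => /andP[h _]; have [] := dF x (lt_trans n0 h).
  + exact: (cvg_at_right_filter (cF _ n0)).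
  + exact: (cvg_at_left_filter (cF _ a0)).
- move=> x; rewrite in_itv/= => /andP[h _].
  by rewrite derive1E; have [_ ->] := dF x (lt_trans n0 h).
Qed.

End Powers.

(** * Nonincreasing kernels *)

Section Kernels.
Context {R : realType}.
Local Notation mu := (@lebesgue_measure R).
Implicit Types u g k l : R -> R.

Lemma ae_imp (P Q : R -> Prop) : (forall x, P x -> Q x) ->
  {ae mu, forall x, P x} -> {ae mu, forall x, Q x}.
Proof.
move=> PQ; have F := ae_filter_ringOfSetsType mu.
by apply: filterS => x; exact: PQ.
Qed.

Lemma Ri_Fatou (f_ : nat -> R -> R) (f : R -> R) (M : R) :
  (forall n, ib (f_ n)) -> (forall n x, 0 <= f_ n x) -> (forall n, Ri (f_ n) <= M) ->
  measurable_fun setT f -> (forall x, 0 <= f x) ->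
  {ae mu, forall x, f_ n x @[n --> \oo] --> f x} -> ib f /\ Ri f <= M.
Proof.
move=> hi h0 hM mf f0 hae; apply: ge0_le_ib => //.
pose F n x := (f_ n x)%:E.
have mF n : measurable_fun setT (F n) by apply/measurable_EFinP; exact: ib_meas.
have mlim : measurable_fun setT (fun x => limn_einf (F ^~ x)).
  apply: measurableT_comp => //.
  apply: (measurable_fun_limn_esup (f := fun n x => (- F n x)%E)) => n.
  exact: measurableT_comp.
(* Fatou concerns the extended lower limit, which agrees with f almost everywhere. *)
have e : (\int[mu]_x (f x)%:E = \int[mu]_x limn_einf (F ^~ x))%E.
  apply: ae_eq_integral => //; first exact/measurable_EFinP.
  apply: ae_imp hae => x hx _; apply/esym.
  have c : F ^~ x @ \oo --> (f x)%:E by apply: cvg_EFin => //; exact: nearW.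
  by rewrite is_cvg_limn_einfE; [exact/cvg_lim|apply/cvg_ex; eexists; exact: c].
rewrite e; apply: le_trans (fatou mu measurableT mF _) _.
  by move=> n x _; rewrite lee_fin.
rewrite limn_einf_lim; apply: lime_le; first exact: is_cvg_einfs.
apply: nearW => n; apply: le_trans (_ : _ <= \int[mu]_x F n x)%E _.
  by apply: ereal_inf_lbound; exists n => /=.
by rewrite Ri_E// lee_fin.
Qed.

Definition decr k : Prop := [/\ kern k, forall t, t <= 0 -> k t = 0 &
  forall s t, 0 < s -> s <= t -> k t <= k s].

Lemma kap_pos k r : decr k -> 0 < r ->
  ib (fun t => k t * (k r - k (t + r))) /\ kap k r = Ri (fun t => k t * (k r - k (t + r))).
Proof.
move=> [hk k0 kmono] r0; have [ik _ _] := hk.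
have h1 : ib (fun t => k r * k t) by exact: ibZ.
have h2 := ib_autoc r hk.
have e t : k r * k t - k t * k (t + r) = k t * (k r - k (t + r)) by ring.
split; first exact: (ib_ext e (ibB h1 h2)).
rewrite /kap (k0 (- r)) ?addr0 ?oppr_le0 ?(ltW r0)//.
by rewrite -(eq_Ri e) (RiB h1 h2) (RiZ _ ik) (mulrC (k r)).
Qed.

(** Two kernels are allowed because superadditivity needs the mixed terms; k = l gives the sign of
    [kap]. *)
Lemma kap_integrand_ge0 k l r t : decr k -> decr l -> 0 < r ->
  0 <= k t * (l r - l (t + r)).
Proof.
move=> [[_ kge0 _] k0 _] [_ _ lmono] r0.
have [t0|t0] := leP t 0; first by rewrite k0// mul0r.
by rewrite mulr_ge0// subr_ge0 lmono// lerDr ltW.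
Qed.

Lemma kap_ge0 k r : decr k -> r != 0 -> 0 <= kap k r.
Proof.
move=> hk; have [hk' _ _] := hk.
wlog r0 : r / 0 < r.
  move=> hw rn0; have [r0|r0] := ltP 0 r; first exact: hw.
  by rewrite -(kap_even r hk') hw// ?oppr_eq0// oppr_gt0 lt_neqAle rn0.
move=> _; have [_ ->] := kap_pos hk r0.
by apply: Ri_ge0 => t; exact: kap_integrand_ge0.
Qed.

Lemma decrD k l : decr k -> decr l -> decr (fun t => k t + l t).
Proof.
move=> [[ik k0 [B kB]] kn km] [[il l0 [C lC]] ln lm]; split.
- split; [exact: ibD|by move=> t; rewrite addr_ge0|].
  by exists (B + C) => t; rewrite lerD.
- by move=> t t0; rewrite kn// ln// addr0.
- by move=> s t s0 st; rewrite lerD ?km ?lm.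
Qed.

(** [kap] is quadratic in the kernel, and for nonincreasing kernels on the half-line both cross
    terms have nonnegative integrands. *)
Lemma kapD k l r : decr k -> decr l -> r != 0 ->
  kap k r + kap l r <= kap (fun t => k t + l t) r.
Proof.
move=> hk hl; have hkl := decrD hk hl.
have [hk' _ _] := hk; have [hl' _ _] := hl; have [hkl' _ _] := hkl.
wlog r0 : r / 0 < r.
  move=> hw rn0; have [r0|r0] := ltP 0 r; first exact: hw.
  rewrite -(kap_even r hk') -(kap_even r hl') -(kap_even r hkl').
  by rewrite hw// ?oppr_eq0// oppr_gt0 lt_neqAle rn0.
move=> _.
have [i1 ->] := kap_pos hk r0; have [i2 ->] := kap_pos hl r0.
have [i3 ->] := kap_pos hkl r0; rewrite -(RiD i1 i2).
apply: le_Ri => [||t]; [exact: ibD|exact: i3|].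
have h1 := kap_integrand_ge0 t hk hl r0; have h2 := kap_integrand_ge0 t hl hk r0.
rewrite -subr_ge0 [leRHS](_ : _ = k t * (l r - l (t + r)) + l t * (k r - k (t + r))); last by ring.
exact: addr_ge0.
Qed.

(** For a kernel vanishing at 0, [kap k 0] is minus the squared norm of k, so comparisons of weights
    are confined to r != 0; at the origin [W u] vanishes. *)
Lemma W_kap_le u (f g : R -> R) : (forall r, r != 0 -> f r <= g r) -> forall r, W u r * f r <= W u r * g r.
Proof.
move=> fg r; have [->|r0] := eqVneq r 0; first by rewrite W0 !mul0r.
by rewrite ler_wpM2l ?W_ge0// fg.
Qed.

Lemma D_norm_superadd k l u : decr k -> decr l -> sqint u ->
  sqnorm (D k u) + sqnorm (D l u) <= sqnorm (D (fun t => k t + l t) u).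
Proof.
move=> hk hl hu; have [hkl' _ _] := decrD hk hl.
have [hk' _ _] := hk; have [hl' _ _] := hl.
have i1 := ib_W_kap hk' hu; have i2 := ib_W_kap hl' hu.
rewrite (D_norm hk' hu) (D_norm hl' hu) (D_norm hkl' hu) -mulrDr -(RiD i1 i2).
rewrite ler_wpM2l//.
apply: le_Ri => [||r]; [exact: ibD|exact: ib_W_kap|].
rewrite -mulrDr.
apply: (@W_kap_le u (fun r => kap k r + kap l r) (kap (fun t => k t + l t))) => {}r r0.
exact: kapD.
Qed.

(** * The truncated power kernels and two-sided bounds on their weights *)

Variable alpha : R.
Hypothesis a0 : 0 < alpha.
Hypothesis a1 : alpha < 1.

Definition pw (t : R) : R := t `^ (- alpha - 1).

Lemma pw_ge0 t : 0 <= pw t. Proof. exact: powR_ge0. Qed.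

Lemma pw_gt0 t : 0 < t -> 0 < pw t. Proof. exact: powR_gt0. Qed.

Lemma pw_le s t : 0 < s -> s <= t -> pw t <= pw s.
Proof.
move=> s0 st; have t0 := lt_le_trans s0 st.
rewrite /pw -opprD !powRN lef_pV2 ?posrE ?powR_gt0//.
by apply: ge0_ler_powR; rewrite ?nnegrE ?(ltW s0) ?(ltW t0) ?addr_ge0 ?(ltW a0).
Qed.

(** Put q = s / t <= 1, so that pw t = pw s * q^(alpha+1). As alpha + 1 <= 2, the power is at least
    q^2, and 1 - q^2 <= 2 (1 - q). *)
Lemma pw_diff s t : 0 < s -> s <= t -> pw s - pw t <= pw s * (2 * ((t - s) / t)).
Proof.
move=> s0 st; have t0 := lt_le_trans s0 st.
pose q := s / t.
have q0 : 0 < q by rewrite divr_gt0.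
have q1 : q <= 1 by rewrite ler_pdivrMr// mul1r.
have e : pw t = pw s * q `^ (alpha + 1).
  rewrite /pw; have {1}-> : s = t * q by rewrite /q mulrCA mulfV ?gt_eqF// mulr1.
  rewrite powRM ?(ltW t0) ?(ltW q0)// -mulrA -powRD ?(gt_eqF q0) ?implybT//.
  by rewrite (_ : - alpha - 1 + (alpha + 1) = 0) ?powRr0 ?mulr1//; ring.
have h : q ^+ 2 <= q `^ (alpha + 1).
  rewrite -powR_mulrn ?(ltW q0)//; apply: ger_powR; first by rewrite q0.
  by have := a1; lra.
have -> : (t - s) / t = 1 - q by rewrite /q mulrBl mulfV ?gt_eqF.
rewrite e -{1}(mulr1 (pw s)) -mulrBr ler_wpM2l ?pw_ge0//.
by have := sqr_ge0 (1 - q); lra.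
Qed.

(** The power is flattened on (0, e] instead of being replaced by 0 there: a cut-off would jump up
    at e, whereas flattening keeps the kernel, and differences of two such kernels,
    nonincreasing. *)
Definition kn (e t : R) : R := if t \in `]0, +oo[ then pw (Num.max t e) else 0.

Lemma knE e t : 0 < t -> kn e t = pw (Num.max t e).
Proof. by move=> t0; rewrite /kn in_itv/= andbT t0. Qed.

Lemma kn0 e t : t <= 0 -> kn e t = 0.
Proof. by move=> t0; rewrite /kn in_itv/= andbT ltNge t0. Qed.

Lemma kn_ge0 e t : 0 <= kn e t.
Proof. by rewrite /kn; case: ifP => // _; exact: pw_ge0. Qed.

Lemma kn_meas e : measurable_fun setT (kn e).
Proof.
apply: measurable_itv_if; apply: (measurableT_comp (f := pw)).
  exact: measurable_powR.
exact: measurable_maxr.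
Qed.

Lemma kn_mono_t e s t : 0 < s -> s <= t -> kn e t <= kn e s.
Proof.
move=> s0 st; rewrite !knE//; last exact: lt_le_trans st.
by apply: pw_le; rewrite ?lt_max ?s0// ge_max !le_max st lexx orbT.
Qed.

Lemma kn_le_pw e t : 0 < t -> kn e t <= pw t.
Proof. by move=> t0; rewrite knE//; apply: pw_le => //; rewrite le_max lexx. Qed.

Lemma kn_eq e t : 0 < e -> e <= t -> kn e t = pw t.
Proof. by move=> e0 et; rewrite knE ?(lt_le_trans e0)// max_l. Qed.

Lemma kn_bdd e t : 0 < e -> kn e t <= pw e.
Proof.
move=> e0; rewrite /kn; case: ifP => _; last exact: pw_ge0.
by apply: pw_le => //; rewrite le_max lexx orbT.
Qed.

Lemma ib_kn e : 0 < e -> ib (kn e).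
Proof.
move=> e0; have [h1 _] := @Ri_head_powR R 1 e ltr01 e0.
have [h2 _] := Ri_tail_powR a0 e0.
apply: le_ib (kn_meas e) _ (ibD (ibZ (pw e) h1) h2) => t.
rewrite ger0_norm ?kn_ge0// !in_itv/= andbT subrr powRr0.
have [t0|t0] := ltP 0 t; last by rewrite kn0//= addr_ge0 ?mulr0//; case: ifP => // _; exact: pw_ge0.
have [te|te] := leP t e; first by rewrite mulr1 addr0 kn_bdd.
by rewrite mulr0 add0r kn_le_pw.
Qed.

Lemma kern_kn e : 0 < e -> kern (kn e).
Proof.
move=> e0; split; [exact: ib_kn|exact: kn_ge0|].
by exists (pw e) => t; exact: kn_bdd.
Qed.

Lemma decr_kn e : 0 < e -> decr (kn e).
Proof.
by move=> e0; split; [exact: kern_kn|exact: kn0|exact: kn_mono_t].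
Qed.

(** Left of e the subtracted kernel is constant, and from e on the two kernels coincide, so the
    difference inherits monotonicity from [kn d]. *)
Lemma decr_kn_diff d e : 0 < d -> d <= e -> decr (fun t => kn d t - kn e t).
Proof.
move=> d0 de; have e0 := lt_le_trans d0 de.
have key (t : R) : 0 < t -> pw (Num.max t e) <= pw (Num.max t d).
  by move=> t0; apply: pw_le; rewrite ?lt_max ?t0// ge_max !le_max lexx de orbT.
split.
- split; first exact: ibB (ib_kn d0) (ib_kn e0).
  + move=> t; have [t0|t0] := ltP 0 t; last by rewrite !kn0// subrr.
    by rewrite !knE// subr_ge0 key.
  + by exists (pw d) => t; rewrite lerBlDr (le_trans (kn_bdd t d0))// lerDl kn_ge0.
- by move=> t t0; rewrite !kn0// subrr.
- move=> s t s0 st; have t0 := lt_le_trans s0 st.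
  have [et|te] := leP e t.
    rewrite (kn_eq e0 et) (kn_eq d0 (le_trans de et)) subrr subr_ge0 !knE//.
    exact: key.
  have -> : kn e t = kn e s.
    by rewrite !knE// !max_r ?ltW// (le_lt_trans st).
  by rewrite lerD2r kn_mono_t.
Qed.

(** Superadditivity for kn d = kn e + (kn d - kn e) yields at once the growth of the norms and the
    Cauchy estimate. *)
Lemma D_kn_mono d e u : 0 < d -> d <= e -> sqint u ->
  sqnorm (D (kn e) u) + sqnorm (fun x => D (kn d) u x - D (kn e) u x) <= sqnorm (D (kn d) u).
Proof.
move=> d0 de hu; have e0 := lt_le_trans d0 de.
have -> : sqnorm (fun x => D (kn d) u x - D (kn e) u x) = sqnorm (D (fun t => kn d t - kn e t) u).
  apply: eq_Ri => x; congr (_ ^+ 2).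
  rewrite /D -(RiB (ib_D x (kern_kn d0) hu) (ib_D x (kern_kn e0) hu)).
  by apply: eq_Ri => t; ring.
apply: le_trans (D_norm_superadd (decr_kn e0) (decr_kn_diff d0 de) hu) _.
rewrite le_eqVlt; apply/orP; left; apply/eqP; congr sqnorm; congr (D _ u).
by apply/funext => t; rewrite addrC subrK.
Qed.

Definition wt (r : R) : R := `|r| `^ (1 + 2 * alpha).

Lemma wt_pos r : 0 < r -> (wt r)^-1 = r `^ (- alpha - 1) * r `^ (- alpha).
Proof.
move=> r0; rewrite /wt gtr0_norm// -powRN -powRD ?(gt_eqF r0) ?implybT//.
by congr (_ `^ _); ring.
Qed.

Lemma wtV r : (wt r)^-1 = `|r| `^ (- (1 + 2 * alpha)).
Proof. by rewrite /wt powRN. Qed.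

Lemma wt_even r : wt (- r) = wt r. Proof. by rewrite /wt normrN. Qed.

Definition Ckap : R := 2 / (1 - alpha) + alpha^-1.

(** The integral of k(t) (k(r) - k(t + r)) is split at t = r. For t <= r the difference is at most 2
    pw(r) t / r, and the factor t makes the integrand an integrable t^(-alpha): this gives 2 / (1 -
    alpha). For t > r the difference is at most pw(r), and the tail of k gives 1 / alpha. *)
Lemma kap_kn_le e r : 0 < e -> r != 0 -> kap (kn e) r <= Ckap / wt r.
Proof.
move=> e0; wlog r0 : r / 0 < r.
  move=> hw rn0; have [r0|r0] := ltP 0 r; first exact: hw.
  rewrite -(kap_even r (kern_kn e0)) -(wt_even r).
  by rewrite hw// ?oppr_eq0// oppr_gt0 lt_neqAle rn0.
move=> _; have b0 : 0 < 1 - alpha by rewrite subr_gt0.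
have [i ->] := kap_pos (decr_kn e0) r0.
have [h1 b1] := Ri_head_powR b0 r0.
have [h2 b2] := Ri_tail_powR a0 r0.
have rn0 : r != 0 by rewrite gt_eqF.
apply: (@le_trans _ _ (2 * pw r / r * (r `^ (1 - alpha) / (1 - alpha)) + pw r * (r `^ (- alpha) / alpha))); last first.
  rewrite wt_pos// /Ckap -/(pw r).
  have -> : r `^ (1 - alpha) = r * r `^ (- alpha).
    by rewrite powRD ?rn0 ?implybT// powRr1// ltW.
  rewrite le_eqVlt; apply/orP; left; apply/eqP; field.
  by rewrite rn0 gt_eqF// gt_eqF.
apply: (@le_trans _ _ (2 * pw r / r * Ri (fun t => if t \in `]0, r] then t `^ (1 - alpha - 1) else 0) +
   pw r * Ri (fun t => if t \in `]r, +oo[ then t `^ (- alpha - 1) else 0))); last first.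
  rewrite b2 lerD2r ler_wpM2l// divr_ge0 ?(ltW r0)// mulr_ge0//; exact: pw_ge0.
rewrite -(RiZ _ h1) -(RiZ _ h2) -(RiD (ibZ _ h1) (ibZ _ h2)).
apply: le_Ri => [||t]; [exact: i|by apply: ibD; exact: ibZ|].
have [t0|t0] := ltP 0 t; last first.
  rewrite kn0// mul0r addr_ge0// mulr_ge0// ?pw_ge0//; try by case: ifP => // _; exact: powR_ge0.
  by rewrite divr_ge0 ?(ltW r0)// mulr_ge0// pw_ge0.
have tr0 : 0 < t + r by rewrite addr_gt0.
rewrite !in_itv/= t0 /= andbT.
have [tr|tr] := leP t r.
- rewrite mulr0 addr0.
  apply: (@le_trans _ _ (pw t * (pw r * (2 * (t / r))))); last first.
    have -> : t `^ (1 - alpha - 1) = t * pw t.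
      rewrite (_ : 1 - alpha - 1 = 1 + (- alpha - 1)); last by ring.
      by rewrite powRD ?(gt_eqF t0) ?implybT// powRr1// ltW.
    rewrite le_eqVlt; apply/orP; left; apply/eqP; field.
    by rewrite rn0.
  apply: ler_pM; [exact: kn_ge0| |exact: kn_le_pw|].
    by rewrite subr_ge0 kn_mono_t// lerDr ltW.
  (* Taking the maximum with e does not widen the gap: s' - s <= t, while s and s' are at least
     r. *)
  rewrite !knE//; set s := Num.max r e; set s' := Num.max (t + r) e.
  have s0 : 0 < s by rewrite lt_max r0.
  have ss' : s <= s' by rewrite ge_max !le_max lexx lerDr (ltW t0) orbT.
  apply: le_trans (pw_diff s0 ss') _.
  apply: ler_pM; [exact: pw_ge0| | |].
  + by rewrite mulr_ge0// divr_ge0 ?subr_ge0// (le_trans (ltW s0)).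
  + by apply: pw_le => //; rewrite le_max lexx.
  + rewrite ler_wpM2l//; apply: ler_pM.
    * by rewrite subr_ge0.
    * by rewrite invr_ge0 (le_trans (ltW s0)).
    * rewrite lerBlDr ge_max; apply/andP; split.
        by rewrite lerD2l le_max lexx.
      by rewrite -[leLHS]add0r lerD// ?(ltW t0)// le_max lexx orbT.
    * rewrite lef_pV2 ?posrE ?r0 ?(lt_le_trans s0 ss')//.
      by rewrite le_max lerDr (ltW t0).
- rewrite mulr0 add0r mulrC ler_pM ?kn_ge0 ?kn_le_pw//.
    by rewrite subr_ge0 kn_mono_t// lerDr ltW.
  by rewrite lerBlDr (le_trans (kn_le_pw e r0))// lerDl kn_ge0.
Qed.

Definition ckap : R := pw 2 * (1 - pw 2).

Lemma ckap_gt0 : 0 < ckap.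
Proof.
have p2 : 0 < pw 2 by exact: pw_gt0.
rewrite mulr_gt0// subr_gt0 /pw -opprD powRN invf_lt1 ?powR_gt0//.
have := @gt0_ltr_powR R (alpha + 1) (addr_gt0 a0 ltr01) 1 2.
by rewrite powR1; apply; rewrite ?nnegrE// ltr1n.
Qed.

(** Only t in []r, (2 * r)]] is kept. There k(t) >= pw(2r) and k(r) - k(t + r) >= pw(r) - pw(2r),
    truncation being inactive from r on; multiplying by the length r and scaling out pw(r)^2 leaves
    [ckap]. *)
Lemma kap_kn_ge e r : 0 < e -> e <= `|r| -> ckap / wt r <= kap (kn e) r.
Proof.
move=> e0; wlog r0 : r / 0 < r.
  move=> hw er; have [r0|r0] := ltP 0 r; first exact: hw.
  rewrite -(kap_even r (kern_kn e0)) -(wt_even r) hw// ?normrN//.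
  by rewrite oppr_gt0 lt_neqAle r0 andbT; apply: contraTN er => /eqP ->; rewrite normr0 -ltNge.
rewrite gtr0_norm// => er; have rn0 : r != 0 by rewrite gt_eqF.
have [i ->] := kap_pos (decr_kn e0) r0.
have r20 : 0 < 2 * r by rewrite mulr_gt0.
have p2 : pw (2 * r) = pw 2 * pw r by rewrite /pw powRM// ltW.
pose c := pw (2 * r) * (pw r - pw (2 * r)).
have c0 : 0 <= c.
  by rewrite mulr_ge0 ?pw_ge0// subr_ge0 pw_le//; lra.
have rr2 : r < 2 * r by lra.
have hc : ib (fun t => if t \in `]r, (2 * r)] then c else 0).
  exact: ib_itv_cst.
apply: (@le_trans _ _ (Ri (fun t => if t \in `]r, (2 * r)] then c else 0))).
  rewrite Ri_itv_cst// wt_pos// /c p2 /ckap -/(pw r).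
  have -> : r `^ (- alpha) = r * pw r.
    rewrite /pw -{2}(powRr1 (ltW r0)) -powRD ?rn0 ?implybT//; congr (_ `^ _); ring.
  rewrite le_eqVlt; apply/orP; left; apply/eqP; ring.
apply: le_Ri => // t; case: ifPn => [|_]; last exact: (kap_integrand_ge0 t (decr_kn e0) (decr_kn e0) r0).
rewrite in_itv/= => /andP[rt tr].
have t0 := lt_trans r0 rt.
apply: ler_pM; [exact: pw_ge0|by rewrite subr_ge0 pw_le// ltW| |].
- by rewrite kn_eq ?pw_le//; lra.
- rewrite (kn_eq e0 er) (kn_eq (t := t + r) e0); last by lra.
  by rewrite lerD2l lerN2 pw_le//; lra.
Qed.

End Kernels.

(** * The Gagliardo integral *)

Section Gagliardo.
Context {R : realType}.
Local Notation mu := (@lebesgue_measure R).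
Implicit Types u g k l : R -> R.

Lemma L2P u : L2 u <-> sqint u.
Proof.
rewrite /L2 /=; split=> [h|[mu_ hu]].
- split; first by move: h; rewrite inE => /andP[/[!inE]/= ].
  by apply/ibP; exact: Lfun2_integrable_sqr.
- rewrite inE; apply/andP; split; rewrite inE//=.
  rewrite /finite_norm unlock /Lnorm poweR_lty//=.
  rewrite (_ : (\int[mu]_x _)%E = (\int[mu]_x (u x ^+ 2)%:E)%E); first exact: ib_lty.
  by apply: eq_integral => x _; rewrite powR_mulrn// real_normK ?num_real.
Qed.

Lemma sqint_locally_integrable u : sqint u -> locally_integrable setT u.
Proof.
move=> hu; have [mu_ iu] := hu; split=> //; first exact: openT.
move=> K _ cK; have mK := compact_measurable cK.
have mu2 : measurable_fun setT (fun x => (u x ^+ 2)%:E).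
  by apply/measurable_EFinP; exact: measurable_funX.
apply: (@le_lt_trans _ _ (\int[mu]_(x in K) (1%:E + (u x ^+ 2)%:E))%E).
  apply: ge0_le_integral => //.
  - by apply/measurable_EFinP; apply: measurable_funTS; exact: measurableT_comp.
  - by apply: emeasurable_funD => //; exact: measurable_funTS.
  - move=> x _; rewrite -EFinD lee_fin.
    have := sqr_ge0 (`|u x| - 1); have := normr_ge0 (u x).
    rewrite -(real_normK (num_real (u x))); lra.
rewrite ge0_integralD//; last first.
  - exact: measurable_funTS.
  - by move=> x _; rewrite lee_fin sqr_ge0.
rewrite lte_add_pinfty//.
  by rewrite integral_cst// mul1e; exact: compact_finite_measure.
apply: le_lt_trans (ib_lty iu); apply: ge0_subset_integral => //.
by move=> x _; rewrite lee_fin sqr_ge0.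
Qed.

Variable alpha : R.
Hypothesis a0 : 0 < alpha.
Hypothesis a1 : alpha < 1.
Local Notation wt := (wt alpha).
Local Notation kn := (kn alpha).

Lemma wt_ge0 r : 0 <= wt r. Proof. exact: powR_ge0. Qed.

Lemma Wwt_ge0 u r : 0 <= W u r / wt r.
Proof. by rewrite divr_ge0 ?W_ge0 ?wt_ge0. Qed.

Lemma Wwt_meas u : measurable_fun setT u -> measurable_fun setT (fun r => W u r / wt r).
Proof.
move=> mu_; apply: measurable_funM; first exact: W_meas.
under eq_fun do rewrite wtV.
apply: (measurableT_comp (f := fun x : R => x `^ (- (1 + 2 * alpha)))); first exact: measurable_powR.
exact: normr_measurable.
Qed.

(** In the variables y and r = x - y the denominator depends on r alone, and Tonelli leaves the
    squared norm of u(. + r) - u, which is [W u r] by evenness. *)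
Lemma Gagliardo_polar u : sqint u ->
  (\int[mu]_y \int[mu]_x (`|u x - u y| ^+ 2 / `|x - y| `^ (1 + 2 * alpha))%:E =
   \int[mu]_r (W u r / wt r)%:E)%E.
Proof.
move=> hu.
pose F (y x : R) := `|u x - u y| ^+ 2 / `|x - y| `^ (1 + 2 * alpha).
pose H (z : R * R) := (u (z.1 + z.2) - u z.1) ^+ 2 * (`|z.2| `^ (- (1 + 2 * alpha))).
have mp : measurable_fun setT (fun x : R => `|x| `^ (- (1 + 2 * alpha))).
  apply: (measurableT_comp (f := fun x : R => x `^ (- (1 + 2 * alpha)))); last exact: normr_measurable.
  exact: measurable_powR.
have mu_ := hu.1.
have mH : measurable_fun setT H.
  apply: measurable_funM; last exact: (measurableT_comp mp).
  apply: measurable_funX; apply: measurable_funB; last exact: (measurableT_comp mu_).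
  by apply: measurableT_comp => //; exact: measurable_funD.
have H0 z : 0 <= H z by rewrite mulr_ge0 ?sqr_ge0 ?powR_ge0.
have e1 y : (\int[mu]_x (F y x)%:E = \int[mu]_r (H (y, r))%:E)%E.
  rewrite -(@ge0_integral_affine _ (fun x => (F y x)%:E) y 1 (or_introl erefl)).
  - apply: eq_integral => r _; rewrite /F /H /= mul1r -powRN real_normK ?num_real//.
    by rewrite (addrC y) addrK.
  - apply/measurable_EFinP; apply: measurable_funM.
      by apply: measurable_funX; apply: measurableT_comp => //; exact: measurable_funB.
    under eq_fun do rewrite -powRN.
    by apply: (measurableT_comp mp); exact: measurable_funB.
  - by move=> x; rewrite lee_fin divr_ge0 ?powR_ge0 ?sqr_ge0.
transitivity (\int[mu]_y \int[mu]_r (H (y, r))%:E)%E.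
  by apply: eq_integral => y _; exact: e1.
rewrite (ge0_Tonelli mH H0); apply: eq_integral => r _.
have h : ib (fun y => (u (y + r) - u y) ^+ 2).
  exact: (sqintB (sqint_shift r hu) hu).2.
transitivity (\int[mu]_y (`|r| `^ (- (1 + 2 * alpha)) * (u (y + r) - u y) ^+ 2)%:E)%E.
  by apply: eq_integral => y _; rewrite /H /= mulrC.
rewrite (Ri_E (ibZ _ h)) (RiZ _ h) mulrC powRN; congr (_ * _)%:E.
rewrite -(W_even _ hu) /W; apply: eq_Ri => y.
by rewrite opprK -sqrrN opprB.
Qed.

Lemma tilde_HP u : tilde_H alpha u <-> sqint u /\ ib (fun r => W u r / wt r).
Proof.
rewrite /tilde_H /=; split=> [[/L2P hu h]|[hu h]].
- split=> //; apply: ge0_ib; [exact: Wwt_meas hu.1|exact: Wwt_ge0|].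
  by rewrite -Gagliardo_polar.
- by split; [exact/L2P|rewrite Gagliardo_polar//; exact: ib_lty].
Qed.

Lemma D_kn_bounded u e : sqint u -> ib (fun r => W u r / wt r) -> 0 < e ->
  sqnorm (D (kn e) u) <= 2^-1 * (Ckap alpha * Ri (fun r => W u r / wt r)).
Proof.
move=> hu h e0; rewrite (D_norm (kern_kn a0 e0) hu) ler_wpM2l// -(RiZ _ h).
apply: le_Ri => [||r]; [exact: ib_W_kap (kern_kn a0 e0) hu|exact: ibZ|].
rewrite mulrCA; apply: (@W_kap_le R u (kap (kn e)) (fun r => Ckap alpha / wt r)) => {}r r0.
exact: kap_kn_le.
Qed.

(** The lower bound on [kap] holds only for |r| >= e, so the Gagliardo integrand is truncated to
    that region; nonnegativity of [kap] handles the rest, and Fatou removes the truncation. *)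
Lemma bounded_D_kn u (M : R) : sqint u -> (forall n : nat, sqnorm (D (kn n.+1%:R^-1) u) <= M) ->
  ib (fun r => W u r / wt r).
Proof.
move=> hu hM; have c0 := ckap_gt0 a0.
have e0 (n : nat) : 0 < n.+1%:R^-1 :> R by rewrite invr_gt0.
pose f_ (n : nat) r := if n.+1%:R^-1 <= `|r| then W u r / wt r else 0.
have f0 n r : 0 <= f_ n r by rewrite /f_; case: ifP => // _; exact: Wwt_ge0.
have fle n r : f_ n r <= (ckap alpha)^-1 * (W u r * kap (kn n.+1%:R^-1) r).
  rewrite ler_pdivlMl// /f_; case: ifPn => [h|_].
    rewrite mulrCA ler_wpM2l ?W_ge0//; exact: kap_kn_ge.
  rewrite mulr0 -(mulr0 (W u r)).
  apply: (@W_kap_le R u (fun=> 0) (kap (kn n.+1%:R^-1))) => {}r r0.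
  by apply: kap_ge0 => //; exact: decr_kn.
have mf n : measurable_fun setT (f_ n).
  apply: measurable_fun_ifT; [|exact: Wwt_meas hu.1|exact: measurable_cst].
  by apply: measurable_fun_ler => //; exact: measurableT_comp.
have ik n := ibZ (ckap alpha)^-1 (ib_W_kap (kern_kn a0 (e0 n)) hu).
have fi n : ib (f_ n).
  by apply: le_ib (ik n) => // r; rewrite ger0_norm.
have fM n : Ri (f_ n) <= (ckap alpha)^-1 * (2 * M).
  apply: le_trans (le_Ri (fi n) (ik n) (fle n)) _.
  rewrite RiZ; last exact: ib_W_kap (kern_kn a0 (e0 n)) hu.
  rewrite ler_wpM2l ?invr_ge0 ?(ltW c0)//.
  have := hM n; rewrite (D_norm (kern_kn a0 (e0 n)) hu); lra.
apply: (Ri_Fatou fi f0 fM (Wwt_meas hu.1) (Wwt_ge0 u) _).1.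
apply: aeW => r; apply: cvg_near_cst.
(* The truncation never releases r = 0, but W vanishes there; at any other r the sequence is
   eventually constant. *)
have [->|r0] := eqVneq r 0.
  by apply: nearW => n; rewrite /f_ W0 mul0r; case: ifP.
near=> n; rewrite /f_ ifT// ltW//; near: n.
have nr : 0 < `|r| by rewrite normr_gt0.
exact: (near_infty_natSinv_lt (PosNum nr)).
Unshelve. all: by end_near. Qed.

End Gagliardo.

(** * Completeness of L2 *)

Section Completeness.
Context {R : realType}.
Local Notation mu := (@lebesgue_measure R).

(** The weighted sum of 4^j d_j^2 has integral at most the sum of 4^j 8^(-j), that is 2. Hence it is
    almost everywhere finite, and its square root serves as C. *)
Lemma ae_summable (d : nat -> R -> R) :
  (forall j, sqint (d j)) -> (forall j, sqnorm (d j) <= 8^-1 ^+ j) ->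
  {ae mu, forall x, exists2 C, 0 <= C & forall j, `|d j x| <= C * 2^-1 ^+ j}.
Proof.
move=> hd dle.
pose h j x := 4 ^+ j * d j x ^+ 2.
have ih j : ib (h j) by apply: ibZ; exact: (hd j).2.
have h0 j x : 0 <= h j x by rewrite mulr_ge0 ?sqr_ge0 ?exprn_ge0.
pose S x := (\sum_(j <oo) (h j x)%:E)%E.
have mh j : measurable_fun setT (fun x => (h j x)%:E).
  by apply/measurable_EFinP; exact: ib_meas (ih j).
have mS : measurable_fun setT S.
  rewrite /S; apply: (ge0_emeasurable_sum (P := xpredT)) => [k x _ _|k _].
    by rewrite lee_fin.
  exact: mh.
have S0 x : (0 <= S x)%E by apply: nneseries_ge0 => j _ _; rewrite lee_fin.
have iS : (\int[mu]_x S x <= 2%:E)%E.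
  rewrite integral_nneseries//; last by move=> j x _; rewrite lee_fin.
  apply: lime_le; first by apply: is_cvg_nneseries => j _ _; apply: integral_ge0 => x _; rewrite lee_fin.
  apply: nearW => n.
  rewrite (eq_bigr (fun j => (Ri (h j))%:E)); last by move=> j _; rewrite (Ri_E (ih j)).
  rewrite sumEFin lee_fin.
  apply: (@le_trans _ _ (\sum_(0 <= j < n) 2^-1 ^+ j)).
    apply: ler_sum => j _; rewrite (RiZ _ (hd j).2).
    apply: (@le_trans _ _ (4 ^+ j * 8^-1 ^+ j)).
      by rewrite ler_wpM2l ?exprn_ge0// dle.
    by rewrite -exprMn (_ : 4 * 8^-1 = 2^-1 :> R)//; field.
  have -> : \sum_(0 <= j < n) 2^-1 ^+ j = 2 - 2 * 2^-1 ^+ n :> R.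
    elim: n => [|n ih']; first by rewrite big_geq// expr0 mulr1 subrr.
    by rewrite big_nat_recr//= ih' exprS; field.
  by rewrite gerBl mulr_ge0// exprn_ge0.
have iS' : mu.-integrable setT S.
  apply/integrableP; split=> //.
  under eq_integral => x _ do rewrite gee0_abs//.
  by rewrite (le_lt_trans iS)// ltry.
apply: ae_imp (integrable_ae measurableT iS') => x /(_ I) fS.
exists (Num.sqrt (fine (S x))); first exact: sqrtr_ge0.
move=> j.
have hj : h j x <= fine (S x).
  rewrite -lee_fin fineK//.
  apply: le_trans (nneseries_lim_ge j.+1 _); last by move=> k _ _; rewrite lee_fin.
  rewrite big_nat_recr//= leeDr// sume_ge0// => k _; rewrite lee_fin//.
rewrite -(@ler_pXn2r _ 2)// ?nnegrE ?mulr_ge0 ?sqrtr_ge0 ?exprn_ge0//.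
rewrite exprMn sqr_sqrtr ?fine_ge0// real_normK ?num_real//.
rewrite -exprM mulnC exprM (_ : 2^-1 ^+ 2 = 4^-1 :> R); last by field.
by rewrite exprVn ler_pdivlMr ?exprn_gt0// mulrC.
Qed.

Lemma summable_diff_cvg (a : nat -> R) (C : R) : 0 <= C ->
  (forall j, `|a j.+1 - a j| <= C * 2^-1 ^+ j) -> cvgn a.
Proof.
move=> C0 h.
have c : cvgn (series (telescope a)).
  apply: normed_cvg.
  apply: (@series_le_cvg _ _ (geometric C 2^-1)).
  - by move=> n; exact: normr_ge0.
  - by move=> n; rewrite /geometric /= mulr_ge0 ?exprn_ge0.
  - by move=> n; rewrite /geometric/telescope /= h.
  - by apply: is_cvg_geometric_series; rewrite ger0_norm// invf_lt1 ?ltr1n.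
have -> : a = (fun n => a 0%N + series (telescope a) n).
  by apply/funext => n; exact: eq_sum_telescope.
by apply: is_cvgD => //; exact: is_cvg_cst.
Qed.

(** N stands for the squared norms of truncated differences: bounded, nondecreasing, with increments
    dominating those of g. Its convergence makes g Cauchy, and a subsequence with rate 8^(-j)
    converges almost everywhere. *)
Lemma L2_complete (g : nat -> R -> R) (N : nat -> R) (M : R) :
  (forall n, sqint (g n)) ->
  (forall n m, (n <= m)%N -> sqnorm (fun x => g m x - g n x) <= N m - N n) ->
  (forall n, N n <= M) ->
  exists v, sqint v /\ exists s : nat -> nat, (forall i, (i <= s i)%N) /\
    forall i, sqnorm (fun x => v x - g (s i) x) <= 8^-1 ^+ i.
Proof.
move=> hg hN NM.
have ndN : nondecreasing_seq N.
  by move=> n m nm; rewrite -subr_ge0; apply: le_trans (hN _ _ nm); exact: sqnorm_ge0.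
have cN : cvgn N.
  by apply: nondecreasing_is_cvgn => //; exists M => _ [n _ <-].
set L := limn N.
have NL n : N n <= L by exact: nondecreasing_cvgn_le.
have ex j : exists k, L - N k <= 8^-1 ^+ j.
  have /cvgrPdist_le /(_ (8^-1 ^+ j)) := cN.
  have p : (0 : R) < 8^-1 ^+ j by rewrite exprn_gt0// invr_gt0.
  move=> /(_ p) [k _ /(_ k (leqnn k))]; rewrite ger0_norm ?subr_ge0// => hk.
  by exists k.
have [k hk] := choice ex.
(* The running maximum makes s monotone, and the terms i force s j >= j. *)
pose s j := (\max_(i < j.+1) maxn i (k i))%N.
have ks j : (k j <= s j)%N.
  by apply: leq_trans (leq_bigmax (ord_max : 'I_j.+1)); rewrite leq_maxr.
have js j : (j <= s j)%N.
  by apply: leq_trans (leq_bigmax (ord_max : 'I_j.+1)); rewrite leq_maxl.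
have ss i j : (i <= j)%N -> (s i <= s j)%N.
  move=> ij; apply/bigmax_leqP => l _.
  have lj : (l < j.+1)%N by rewrite (leq_trans (ltn_ord l)).
  exact: (@leq_bigmax _ (fun l : 'I_j.+1 => maxn l (k l)) (Ordinal lj)).
have sL j : L - N (s j) <= 8^-1 ^+ j.
  by apply: le_trans (hk j); rewrite lerD2l lerN2; exact: ndN.
have gs i j : (i <= j)%N -> sqnorm (fun x => g (s j) x - g (s i) x) <= 8^-1 ^+ i.
  move=> ij; apply: le_trans (hN _ _ (ss _ _ ij)) _.
  by apply: le_trans (sL i); rewrite lerD2r.
(* An upper limit is measurable without any convergence; where the subsequence diverges, a null set,
   the value is immaterial. *)
pose v x := fine (limn_esup (fun j => (g (s j) x)%:E)).
have hae : {ae mu, forall x, g (s j) x @[j --> \oo] --> v x}.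
  have hd j : sqint (fun x => g (s j.+1) x - g (s j) x) by exact: sqintB.
  apply: ae_imp (ae_summable hd (fun j => gs _ _ (leqnSn j))) => x [C C0 hC].
  have c := summable_diff_cvg C0 hC.
  suff -> : v x = limn (fun j => g (s j) x) by [].
  rewrite /v is_cvg_limn_esupE.
    by rewrite EFin_lim.
  by apply/cvg_ex; exists (limn (fun j => g (s j) x))%:E; apply: cvg_EFin => //; exact: nearW.
have mv : measurable_fun setT v.
  apply: (measurableT_comp (fine_measurable measurableT)).
  apply: (measurable_fun_limn_esup (f := fun j x => (g (s j) x)%:E)) => j.
  by apply/measurable_EFinP; exact: (hg (s j)).1.
(* Fatou in j, with i fixed, turns the Cauchy estimate into a distance to the limit. *)
have key i : ib (fun x => (v x - g (s i) x) ^+ 2) /\ sqnorm (fun x => v x - g (s i) x) <= 8^-1 ^+ i.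
  apply: (@Ri_Fatou _ (fun j x => (g (s (j + i)%N) x - g (s i) x) ^+ 2)).
  - by move=> j; exact: (sqintB (hg _) (hg _)).2.
  - by move=> j x; exact: sqr_ge0.
  - by move=> j; apply: gs; exact: leq_addl.
  - by apply: measurable_funX; apply: measurable_funB => //; exact: (hg (s i)).1.
  - by move=> x; exact: sqr_ge0.
  - apply: ae_imp hae => x hx.
    have h1 : g (s (j + i)%N) x @[j --> \oo] --> v x by rewrite (cvg_shiftn i (fun j => g (s j) x)).
    have h2 : (g (s (j + i)%N) x - g (s i) x) @[j --> \oo] --> v x - g (s i) x.
      by apply: cvgB => //; exact: cvg_cst.
    by rewrite expr2; under eq_fun do rewrite expr2; exact: cvgM.
exists v; split; last by exists s; split=> // i; exact: (key i).2.
have h : sqint (fun x => v x - g (s 0%N) x).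
  by split; [apply: measurable_funB => //; exact: (hg _).1|exact: (key 0%N).1].
have e : v = (fun x => (v x - g (s 0%N) x) + g (s 0%N) x) by apply/funext => x; rewrite subrK.
by rewrite e; exact: sqintD.
Qed.

End Completeness.

(** * Test functions *)

Section TestFunctions.
Context {R : realType}.
Local Notation mu := (@lebesgue_measure R).
Implicit Types phi : R -> R.

(** All that the estimates use of a test function. The support and the derivative bound are explicit
    because the errors must be controlled uniformly over translates of a mollifier. *)
Definition C1c phi (a b C : R) : Prop := [/\ forall x, derivable phi x 1,
  continuous (derive1 phi), forall x, x < a \/ b < x -> phi x = 0 /\ (derive1 phi) x = 0, 0 <= C &
  forall x, `|(derive1 phi) x| <= C].

Lemma derive1_eq0 (phi : R -> R) (A : set R) x : open A -> A x ->
  (forall y, A y -> phi y = 0) -> (derive1 phi) x = 0.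
Proof.
move=> oA Ax h.
have e : \near x, phi x = cst 0 x.
  by near=> y; apply: h; near: y; apply: open_nbhs_nbhs.
by rewrite derive1E (near_eq_derive _ e) derive_cst.
Unshelve. all: by end_near. Qed.

Lemma test_function_C1c phi : test_function phi -> exists a b C, C1c phi a b C.
Proof.
move=> [hd hc]; have [M [_ hM]] := compact_bounded hc.
have d0 x : derivable phi x 1 by have := hd 0%N x.
have d1 x : derivable (derive1 phi) x 1 by have := hd 1%N x.
have c1 : continuous (derive1 phi) by move=> x; exact: derivable_continuous.
pose a := - (M + 1); pose b := M + 1.
have p0 x : x < a \/ b < x -> phi x = 0.
  move=> hx; apply: contrapT => /eqP h.
  have : `|x| <= M + 1 by apply: (hM (M + 1)); [rewrite ltrDl|exact: subset_closure].
  by rewrite ler_norml; case: hx => h'; rewrite /a /b in h'; lra.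
have p1 x : x < a \/ b < x -> (derive1 phi) x = 0.
  case=> hx.
  - by apply: (@derive1_eq0 _ [set y | y < a]) ; [exact: open_lt|exact: hx|move=> y ya; apply: p0; left].
  - by apply: (@derive1_eq0 _ [set y | b < y]) ; [exact: open_gt|exact: hx|move=> y ya; apply: p0; right].
have cK : compact ((derive1 phi) @` `[a, b]).
  apply: continuous_compact; last exact: segment_compact.
  exact: continuous_subspaceT.
have [C [_ hC]] := compact_bounded cK.
exists a, b, (`|C| + 1); split=> //.
- by move=> x hx; rewrite p0// p1.
- move=> x; have [xa|xa] := ltP x a; first by rewrite p1 ?normr0; [|left].
  have [bx|bx] := ltP b x; first by rewrite p1 ?normr0; [|right].
  apply: (hC (`|C| + 1)); first by rewrite ltr_pwDr// ler_norm.
  by exists x => //; rewrite /= in_itv/= xa.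
Qed.

(** * One-sided differences of a C1 function: s = 1 looks to the right, s = -1 to the left *)

Section C1c.
Variables (phi : R -> R) (a b C s : R).
Hypothesis hn : C1c phi a b C.
Hypothesis hs : s = 1 \/ s = -1.

Lemma sign_sqr : s * s = 1. Proof. by case: hs => ->; rewrite ?mulr1 ?mulrNN ?mulr1. Qed.
Lemma sign_norm : `|s| = 1. Proof. by case: hs => ->; rewrite ?normrN normr1. Qed.

Lemma C1c_meas1 : measurable_fun setT (derive1 phi).
Proof. by have [_ hc _ _ _] := hn; exact: continuous_measurable_fun. Qed.

Lemma C1c_cont : continuous phi.
Proof. by have [hd _ _ _ _] := hn; move=> x; exact: derivable_continuous. Qed.

Lemma C1c_meas : measurable_fun setT phi.
Proof. by apply: continuous_measurable_fun; exact: C1c_cont. Qed.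

Lemma C1c_supp x : `|(derive1 phi) x| <= if x \in `[a, b] then C else 0.
Proof.
have [_ _ h0 C0 hC] := hn; rewrite in_itv/=.
have [xa|ax] := ltP x a; first by rewrite (h0 x _).2 ?normr0//; left.
by have [bx|xb] := ltP b x; first by rewrite (h0 x _).2 ?normr0//; right.
Qed.

Lemma C1c_ib1 : ib (derive1 phi).
Proof. by apply: le_ib C1c_meas1 C1c_supp (ib_itv_cst _ _ _ _ _). Qed.

Lemma C1c_is_derive (x r : R) : is_derive r 1 (fun r : R => phi (x + s * r)) (s * (derive1 phi) (x + s * r)).
Proof.
have [hd _ _ _ _] := hn.
have h1 : is_derive (x + s * r) 1 phi ((derive1 phi) (x + s * r)).
  by rewrite derive1E; exact: derivableP.
have h2 : is_derive r 1 (fun r : R => x + s * r) s.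
  have := is_deriveD (is_derive_cst x r 1) (is_deriveZ s (is_derive_id r 1)).
  by move=> h; apply: is_derive_eq h _; rewrite add0r /GRing.scale /= mulr1.
have := @is_derive1_comp R phi (fun r : R => x + s * r) r _ _ h1 h2; by rewrite mulrC.
Qed.

Lemma C1c_FTC x t : 0 < t ->
  Ri (fun r => if r \in `]0, t[ then (derive1 phi) (x + s * r) else 0) = s * (phi (x + s * t) - phi x).
Proof.
move=> t0; have [hd hc _ _ _] := hn.
have m1 : measurable_fun setT (fun r => (derive1 phi) (x + s * r)).
  by apply: measurable_comp_affine; exact: C1c_meas1.
have ms : measurable_fun setT (fun r => s * (derive1 phi) (x + s * r)) by exact: measurable_funM.
have i1 : ib (fun r => if r \in `]0, t[ then s * (derive1 phi) (x + s * r) else 0).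
  apply: le_ib (measurable_itv_if _ ms) _ (ib_norm (ib_affine x hs C1c_ib1)) => r.
  by case: ifP => _; rewrite ?normr0// normrM sign_norm mul1r.
have e : Ri (fun r => if r \in `]0, t[ then s * (derive1 phi) (x + s * r) else 0) = phi (x + s * t) - phi x.
  apply: EFin_inj; rewrite -(Ri_E i1) ge0_integral_itv.
  rewrite -(@integral_itv_bndoo _ _ _ _ true false); last first.
    by apply/measurable_EFinP; exact: measurable_funTS.
  have cF r : {for r, continuous (fun r => phi (x + s * r))}.
    by apply: derivable_continuous; have [] := C1c_is_derive x r.
  rewrite (@continuous_FTC2 _ _ (fun r => phi (x + s * r)) _ _ t0).
  - by rewrite mulr0 addr0 EFinB.
  - apply: continuous_subspaceT => r; apply: cvgM; first exact: cvg_cst.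
    apply: (continuous_comp (f := fun r => x + s * r)); last exact: hc.
    by apply: cvgD; [exact: cvg_cst|apply: cvgM; [exact: cvg_cst|exact: cvg_id]].
  - split.
    + by move=> r _; have [] := C1c_is_derive x r.
    + exact: (cvg_at_right_filter (cF 0)).
    + exact: (cvg_at_left_filter (cF t)).
  - by move=> r _; rewrite derive1E; have [_ ->] := C1c_is_derive x r.
rewrite -e -(RiZ s i1); apply: eq_Ri => r.
by case: ifP => _; rewrite ?mulr0// mulrA sign_sqr mul1r.
Qed.

Variable alpha : R.
Hypothesis a0 : 0 < alpha.
Hypothesis a1 : alpha < 1.
Local Notation kn := (kn alpha).

(** Gamma(1 - alpha) times the fractional integral of order 1 - alpha, right for s = 1 and left for
    s = -1. *)
Definition Vint (f : R -> R) x : R :=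
  Ri (fun t => if t \in `]0, +oo[ then f (x + s * t) * t `^ (- alpha) else 0).

Definition Dt e x : R := Ri (fun t => kn e t * (phi x - phi (x + s * t))).

Definition qk e r : R := Ri (fun t => if t \in `]r, +oo[ then kn e t else 0).

Lemma ib_qk e r : 0 < e -> ib (fun t => if t \in `]r, +oo[ then kn e t else 0).
Proof.
move=> e0; apply: le_ib (measurable_itv_if _ (kn_meas alpha e)) _ (ib_kn a0 e0) => t.
by case: ifP => _; rewrite ?normr0 ?kn_ge0// ger0_norm// kn_ge0.
Qed.

Lemma qk_ge0 e r : 0 <= qk e r.
Proof. by apply: Ri_ge0 => t; case: ifP => // _; exact: kn_ge0. Qed.

Lemma qk_le e r : 0 < e -> 0 < r -> qk e r <= r `^ (- alpha) / alpha.
Proof.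
move=> e0 r0; have [h <-] := Ri_tail_powR a0 r0.
apply: le_Ri => //; first exact: ib_qk.
move=> t; case: ifPn => //; rewrite in_itv/= andbT => rt.
by apply: (kn_le_pw a0); exact: lt_trans rt.
Qed.

Lemma qk_eq e r : 0 < e -> e <= r -> qk e r = r `^ (- alpha) / alpha.
Proof.
move=> e0 er; have r0 := lt_le_trans e0 er; have [_ <-] := Ri_tail_powR a0 r0.
apply: eq_Ri => t; case: ifPn => //; rewrite in_itv/= andbT => rt.
by apply: (kn_eq _ e0); rewrite (le_trans er)// ltW.
Qed.

(** Integration by parts in t, done as Fubini: phi(x) - phi(x + s t) is -s times the integral of
    phi'(x + s r) over 0 < r < t, and integrating k over t > r first produces the tail [qk]. *)
Lemma Dt_qk e x : 0 < e ->
  ib (fun r => if r \in `]0, +oo[ then (derive1 phi) (x + s * r) * qk e r else 0) /\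
  Dt e x = - s * Ri (fun r => if r \in `]0, +oo[ then (derive1 phi) (x + s * r) * qk e r else 0).
Proof.
move=> e0; have ik := ib_kn a0 e0.
pose F (z : R * R) : R := if (0 < z.2) && (z.2 < z.1) then kn e z.1 * (derive1 phi) (x + s * z.2) else 0.
have mF : measurable_fun setT F.
  apply: measurable_fun_ifT.
  - apply: measurable_and.
      by apply: measurable_fun_ltr.
    by apply: measurable_fun_ltr.
  - apply: measurable_funM; first exact: (measurableT_comp (kn_meas alpha e)).
    apply: (measurableT_comp C1c_meas1); apply: measurable_funD => //.
    exact: measurable_funM.
  - exact: measurable_cst.
have i1 := ib_affine x hs C1c_ib1.
have FE t r : F (t, r) = kn e t * (if r \in `]0, t[ then (derive1 phi) (x + s * r) else 0).
  by rewrite /F /= in_itv /=; case: ifP => _; rewrite ?mulr0.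
have ir t : ib (fun r => if r \in `]0, t[ then (derive1 phi) (x + s * r) else 0).
  apply: le_ib (measurable_itv_if _ _) _ (ib_norm i1).
    by apply: measurable_comp_affine; exact: C1c_meas1.
  by move=> r; case: ifP => _; rewrite ?normr0.
have [t|h1 h2 h] := @Ri_Fubini _ F (fun t => Ri (fun r => `|(derive1 phi) (x + s * r)|) * kn e t) mF (ibZ _ ik).
  split; first by apply: ib_ext (ibZ (kn e t) (ir t)) => r; rewrite FE.
  rewrite (@eq_Ri _ _ (fun r => kn e t * `|if r \in `]0, t[ then (derive1 phi) (x + s * r) else 0|)); last first.
    by move=> r; rewrite FE normrM ger0_norm ?kn_ge0.
  rewrite (RiZ _ (ib_norm (ir t))) mulrC ler_wpM2r ?kn_ge0//.
  apply: le_Ri; [exact: ib_norm|exact: ib_norm|].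
  by move=> r; case: ifP => _; rewrite ?normr0.
have E2 r : Ri (fun t => F (t, r)) = if r \in `]0, +oo[ then (derive1 phi) (x + s * r) * qk e r else 0.
  rewrite in_itv /= andbT /F /=; have [r0|r0] := ltP 0 r => /=; last exact: Ri0.
  rewrite /qk -(RiZ _ (ib_qk r e0)); apply: eq_Ri => t.
  by rewrite in_itv/= andbT; case: ifP => _; [exact: mulrC|rewrite mulr0].
split; first exact: (ib_ext E2 h2).
rewrite -(eq_Ri E2) -h -(RiZ _ h1); apply: eq_Ri => t.
have [t0|t0] := ltP 0 t; last first.
  have F0 r : F (t, r) = 0 by rewrite FE (kn0 _ _ t0) mul0r.
  by rewrite (kn0 _ _ t0) mul0r (eq_Ri F0) Ri0 mulr0.
rewrite (eq_Ri (FE t)) (RiZ _ (ir t)) (C1c_FTC x t0).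
have -> (k y : R) : - s * (k * (s * y)) = - ((s * s) * (k * y)) by ring.
by rewrite sign_sqr; ring.
Qed.

Lemma C1c_bdd : exists C', forall x, `|phi x| <= C'.
Proof.
have [_ _ h0 _ _] := hn.
have cK : compact (phi @` `[a, b]).
  apply: continuous_compact; last exact: segment_compact.
  by apply: continuous_subspaceT; exact: C1c_cont.
have [M [_ hM]] := compact_bounded cK.
exists (`|M| + 1) => x.
have [xa|xa] := ltP x a; first by rewrite (h0 x _).1 ?normr0//; left.
have [bx|bx] := ltP b x; first by rewrite (h0 x _).1 ?normr0//; right.
apply: (hM (`|M| + 1)); first by rewrite ltr_pwDr// ler_norm.
by exists x => //; rewrite /= in_itv/= xa.
Qed.

(** The bound is uniform for x within 1 of y, as differentiation under the integral requires. Past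
    |y| + |a| + |b| + 2 the point x + s t has left [a, b]. *)
Lemma Vint_dominated (f : R -> R) (B y x : R) :
  (forall x, `|f x| <= B) -> (forall x, x < a \/ b < x -> f x = 0) -> `|x - y| <= 1 ->
  forall t, 0 < t -> `|f (x + s * t) * t `^ (- alpha)| <=
    B * (if t \in `]0, `|y| + `|a| + `|b| + 2] then t `^ (1 - alpha - 1) else 0).
Proof.
move=> fB f0 xy t t0; rewrite in_itv/= t0 (_ : 1 - alpha - 1 = - alpha); last by ring.
rewrite normrM (ger0_norm (powR_ge0 _ _)) /=.
have [tL|Lt] := leP t _; first by rewrite ler_wpM2r ?powR_ge0.
rewrite (f0 (x + s * t)) ?normr0 ?mul0r ?mulr0//.
move: xy; rewrite ler_norml => xy.
have := ler_norm y; have := lerNnormlW (lexx `|y|); have := ler_norm a; have := ler_norm b.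
have := lerNnormlW (lexx `|a|); have := lerNnormlW (lexx `|b|).
have := normr_ge0 y; have := normr_ge0 a; have := normr_ge0 b.
by case: hs => ->; [right|left]; lra.
Qed.

Lemma ib_head_L (B y : R) :
  ib (fun t => B * (if t \in `]0, `|y| + `|a| + `|b| + 2] then t `^ (1 - alpha - 1) else 0)).
Proof.
apply: ibZ; apply: (Ri_head_powR _ _).1; first by rewrite subr_gt0.
by rewrite ltr_wpDl// !addr_ge0.
Qed.

Lemma ib_V (f : R -> R) (B x : R) : measurable_fun setT f ->
  (forall x, `|f x| <= B) -> (forall x, x < a \/ b < x -> f x = 0) ->
  ib (fun t => if t \in `]0, +oo[ then f (x + s * t) * t `^ (- alpha) else 0).
Proof.
move=> mf fB f0.
apply: le_ib (measurable_itv_if _ _) _ (ib_head_L B x).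
  apply: measurable_funM; last exact: measurable_powR.
  exact: measurable_comp_affine.
move=> t; case: ifPn => ht.
  apply: Vint_dominated => //; first by rewrite subrr normr0.
  by move: ht; rewrite in_itv/= andbT.
by rewrite normr0 mulr_ge0 ?(le_trans _ (fB 0))//; case: ifP => // _; exact: powR_ge0.
Qed.

Lemma C1c_ib_V x : ib (fun t => if t \in `]0, +oo[ then (derive1 phi) (x + s * t) * t `^ (- alpha) else 0).
Proof.
have [_ _ h0 C0 hC] := hn.
by apply: (ib_V x C1c_meas1 hC) => y hy; exact: (h0 y hy).2.
Qed.

(** The tail [qk e r] equals r^(-alpha) / alpha for r >= e and lies between 0 and that value below
    e, so the error is an integral over []0, e]]. As e <= 1, it sees phi' only within distance 1 of
    x, hence vanishes off [a - 1, b + 1]. *)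
Lemma Dt_approx e x : 0 < e -> e <= 1 ->
  `|Dt e x - (- s / alpha * Vint (derive1 phi) x)| <=
  if x \in `[a - 1, b + 1] then C / alpha * (e `^ (1 - alpha) / (1 - alpha)) else 0.
Proof.
move=> e0 e1; have [_ _ h0 C0 hC] := hn; have b0 : 0 < 1 - alpha by rewrite subr_gt0.
have [i1 ->] := Dt_qk x e0; have i2 := C1c_ib_V x.
have i3 := ibZ alpha^-1 i2.
have -> : forall A B, - s * A - - s / alpha * B = s * (alpha^-1 * B - A) by move=> A B; ring.
rewrite normrM sign_norm mul1r /Vint -(RiZ _ i2) -(RiB i3 i1).
set g := (fun r => _ - _).
have ig : ib g by exact: ibB.
have gE r : g r = if r \in `]0, +oo[ then (derive1 phi) (x + s * r) * (r `^ (- alpha) / alpha - qk e r) else 0.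
  by rewrite /g; case: ifP => _; ring.
have [hH bH] := Ri_head_powR b0 e0.
have gle r : `|g r| <= C / alpha * (if r \in `]0, e] then r `^ (1 - alpha - 1) else 0).
  rewrite gE (_ : 1 - alpha - 1 = - alpha); last by ring.
  rewrite !in_itv/= andbT; have [r0|r0] := ltP 0 r => /=; last by rewrite normr0 mulr0.
  have [re|er] := leP r e; last by rewrite (qk_eq e0 (ltW er)) subrr mulr0 normr0 mulr0.
  rewrite normrM -mulrA; apply: ler_pM => //.
  rewrite ger0_norm ?subr_ge0 ?qk_le// mulrC gerBl; exact: qk_ge0.
have [xab|xab] := boolP (x \in `[a - 1, b + 1]).
- apply: le_trans (Ri_norm ig) _.
  apply: (@le_trans _ _ (C / alpha * Ri (fun r => if r \in `]0, e] then r `^ (1 - alpha - 1) else 0))).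
    by rewrite -(RiZ _ hH); apply: le_Ri => //; [exact: ib_norm|exact: ibZ].
  by rewrite ler_wpM2l// divr_ge0// ltW.
- suff g0 r : g r = 0 by rewrite (eq_Ri g0) Ri0 normr0.
  rewrite gE in_itv/= andbT; have [r0|r0] := ltP 0 r => //=.
  have [re|er] := leP r e; last by rewrite (qk_eq e0 (ltW er)) subrr mulr0.
  rewrite (h0 (x + s * r) _).2 ?mul0r//.
  move: xab; rewrite in_itv/= negb_and -!ltNge => /orP[] h; [left|right];
  by case: hs => ->; lra.
Qed.

(** After translation x occurs only in phi, so differentiating under the integral never touches the
    singular factor. *)
Lemma Vint_derivable x : derivable (Vint phi) x 1 /\ derive1 (Vint phi) x = Vint (derive1 phi) x.
Proof.
have [hd hc h0 C0 hC] := hn; have [C' hC'] := C1c_bdd.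
pose f (y t : R) := phi (y + s * t) * t `^ (- alpha).
have dshift (y t : R) : is_derive y 1 (fun z : R => f z t) (derive1 phi (y + s * t) * t `^ (- alpha)).
  have h1 : is_derive (y + s * t) 1 phi (derive1 phi (y + s * t)).
    by rewrite derive1E; exact: derivableP.
  have h2 : is_derive y 1 (fun r : R => r + s * t) 1.
    have h := is_deriveD (is_derive_id y 1) (is_derive_cst (s * t) y 1).
    by apply: is_derive_eq h _; rewrite addr0.
  have h3 := @is_derive1_comp R phi (fun r : R => r + s * t) y _ _ h1 h2.
  have h4 := is_deriveZ (t `^ (- alpha)) h3.
  have -> : (fun z : R => f z t) = t `^ (- alpha) \*: (phi \o (fun r : R => r + s * t)).
    by apply/funext => z; rewrite /f /= mulrC.
  by apply: (is_derive_eq h4); rewrite /GRing.scale /= mulr1 mulrC.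
have pE y t : partial1of2 f y t = derive1 phi (y + s * t) * t `^ (- alpha).
  by rewrite partial1of2E; have [_ ->] := dshift y t.
have VE (g : R -> R) : Vint g = (fun x => \int[mu]_(t in `]0, +oo[) (g (x + s * t) * t `^ (- alpha)))%R.
  by apply/funext => y; exact: Ri_itv.
pose G t := C * (if t \in `]0, `|x| + `|a| + `|b| + 2] then t `^ (1 - alpha - 1) else 0).
have mB : measurable (`]0, +oo[%classic : set R) by exact: measurable_itv.
have Ix : (`]x - 1, x + 1[%classic : set R) x by rewrite /= in_itv/=; lra.
have intf y : (`]x - 1, x + 1[%classic : set R) y -> mu.-integrable `]0, +oo[ (EFin \o f y).
  move=> _; apply/(ib_itv `]0, +oo[ (f y)).
  by apply: (ib_V y C1c_meas hC') => z hz; exact: (h0 z hz).1.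
have derf y t : (`]x - 1, x + 1[%classic : set R) y -> (`]0, +oo[%classic : set R) t -> derivable (f ^~ t) y 1.
  by move=> _ _; have [] := dshift y t.
have G0 t : 0 <= G t by rewrite mulr_ge0//; case: ifP => // _; exact: powR_ge0.
have iG : mu.-integrable `]0, +oo[ (EFin \o G).
  apply: (@integrableS _ _ _ mu setT) => //.
  by apply/ibP; exact: ib_head_L.
have Gub y t : (`]x - 1, x + 1[%classic : set R) y -> (`]0, +oo[%classic : set R) t -> `|partial1of2 f y t| <= G t.
  rewrite /= !in_itv/= andbT => hy t0; rewrite pE.
  apply: Vint_dominated => //.
    by move=> z hz; exact: (h0 z hz).2.
  by rewrite ler_norml; lra.
split.
- rewrite VE; exact: (@derivable_under_integral R _ _ mu f _ mB x (x - 1) (x + 1) Ix intf derf G G0 iG Gub).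
- have := @differentiation_under_integral R _ _ mu f _ mB x (x - 1) (x + 1) Ix intf derf G G0 iG Gub.
  rewrite VE (VE (derive1 phi)) => ->.
  by apply: eq_Rintegral => t _; rewrite pE.
Qed.

End C1c.
End TestFunctions.

(** * Fractional derivatives of test functions *)

Section FracDeriv.
Context {R : realType}.
Implicit Types phi u : R -> R.

(** Integrability comes first, since an infinite integral would give the default value 0. Majorants
    are t^(b-1) on (0, 1] and 2 t^(-2) beyond, from t^2 / 2 <= exp t; on (0, 1] the integrand is at
    least exp(-1). *)
Lemma Gamma_gt0 (b : R) : 0 < b -> b < 1 -> 0 < Defs.Gamma b.
Proof.
move=> b0 b1.
have -> : Defs.Gamma b = Ri (fun t => if t \in `]0, +oo[ then t `^ (b - 1) * expR (- t) else 0).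
  by rewrite (Ri_itv `]0, +oo[ (fun t => t `^ (b - 1) * expR (- t))).
have mf : measurable_fun setT (fun t : R => t `^ (b - 1) * expR (- t)).
  apply: measurable_funM; first exact: measurable_powR.
  by apply: (measurableT_comp (@measurable_expR R)).
have [h1 _] := @Ri_head_powR R b 1 b0 ltr01.
have [h2 _] := @Ri_tail_powR R 1 1 ltr01 ltr01.
have hi : ib (fun t => if t \in `]0, +oo[ then t `^ (b - 1) * expR (- t) else 0).
  apply: le_ib (measurable_itv_if _ mf) _ (ibD h1 (ibZ 2 h2)) => t.
  rewrite !in_itv/= !andbT; have [t0|t0] := ltP 0 t => /=; last first.
    rewrite normr0 add0r mulr_ge0//; case: ifP => // _; exact: powR_ge0.
  rewrite ger0_norm ?mulr_ge0 ?powR_ge0 ?expR_ge0//.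
  have [t1|t1] := leP t 1.
    by rewrite mulr0 addr0 ler_piMr ?powR_ge0// expR_le1 oppr_le0 ltW.
  rewrite add0r; apply: (@le_trans _ _ (1 * expR (- t))).
    rewrite ler_wpM2r ?expR_ge0//.
    have bl : b - 1 <= 0 by rewrite subr_le0 ltW.
    by have := ler_powR (ltW t1) bl; rewrite powRr0.
  rewrite mul1r expRN (_ : - 1 - 1 = - 2%:R); last by ring.
  rewrite (powR_invn _ (ltW t0)) ler_pdivlMr ?exprn_gt0// mulrC ler_pdivrMr ?expR_gt0//.
  have := @expR_ge1Dxn R t 1 (ltW t0).
  rewrite (_ : 2`!%:R = 2)//; lra.
apply: (@lt_le_trans _ _ (Ri (fun t => if t \in `]0, (1 : R)] then expR (-1) else 0))).
  by rewrite Ri_itv_cst// subr0 mulr1 expR_gt0.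
apply: le_Ri => //; first exact: ib_itv_cst.
move=> t; rewrite !in_itv/= andbT; have [t0|t0] := ltP 0 t => //=.
have [t1|t1] := leP t 1; last by rewrite mulr_ge0 ?powR_ge0 ?expR_ge0.
rewrite -[leLHS]mul1r; apply: ler_pM => //.
- have bl : b - 1 <= 0 by rewrite subr_le0 ltW.
  have t01 : 0 < t <= 1 by rewrite t0.
  by have := ger_powR t01 bl; rewrite powRr0.
- by rewrite ler_expR lerN2.
Qed.

Variable alpha : R.
Hypothesis a0 : 0 < alpha.
Hypothesis a1 : alpha < 1.
Local Notation kn := (kn alpha).
Local Notation G := (Defs.Gamma (1 - alpha)).

Lemma G_gt0 : 0 < G.
Proof. by apply: Gamma_gt0; [rewrite subr_gt0|rewrite gtrBl]. Qed.

Lemma right_fracintE phi : measurable_fun setT phi ->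
  right_fracint (1 - alpha) phi = fun x => G^-1 * Vint 1 alpha phi x.
Proof.
move=> mphi; apply/funext => x; rewrite /right_fracint; congr (_ * _).
rewrite -(Ri_itv `]x, +oo[ (fun y => phi y / (y - x) `^ (1 - (1 - alpha)))).
rewrite (_ : 1 - (1 - alpha) = alpha); last by ring.
rewrite -(Ri_affine x (or_introl erefl)); last first.
  apply: measurable_itv_if; apply: measurable_funM => //.
  under eq_fun do rewrite -powRN.
  by apply: (measurableT_comp (f := fun t : R => t `^ (- alpha))); [exact: measurable_powR|exact: measurable_funB].
apply: eq_Ri => t; rewrite !in_itv/= !andbT mul1r (addrC x) addrK ltrDr.
by case: ifP => // _; rewrite powRN.
Qed.

Lemma left_fracintE phi : measurable_fun setT phi ->
  left_fracint (1 - alpha) phi = fun x => G^-1 * Vint (-1) alpha phi x.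
Proof.
move=> mphi; apply/funext => x; rewrite /left_fracint; congr (_ * _).
rewrite -(Ri_itv `]-oo, x[ (fun y => phi y / (x - y) `^ (1 - (1 - alpha)))).
rewrite (_ : 1 - (1 - alpha) = alpha); last by ring.
rewrite -(Ri_affine x (or_intror erefl)); last first.
  apply: measurable_itv_if; apply: measurable_funM => //.
  under eq_fun do rewrite -powRN.
  by apply: (measurableT_comp (f := fun t : R => t `^ (- alpha))); [exact: measurable_powR|exact: measurable_funB].
apply: eq_Ri => t; rewrite !in_itv/= !andbT mulN1r opprD opprK addNKr.
have -> : (x - t < x) = (0 < t) by rewrite gtrBl.
by case: ifP => // _; rewrite powRN.
Qed.

(* [s = 1] is the right derivative, [s = -1] the left one. *)
Definition fd (s : R) phi : R -> R := fun x => - s / G * Vint s alpha (derive1 phi) x.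

Lemma derive1_cM (c : R) (f : R -> R) x : derivable f x 1 ->
  derive1 (fun x => c * f x) x = c * derive1 f x.
Proof.
move=> h; rewrite !derive1E.
have hd : is_derive x 1 f ('D_1 f x) by exact: derivableP.
by have [_ e] := is_deriveZ c hd; exact: e.
Qed.

Lemma right_fracderivE phi a b C : C1c phi a b C -> right_fracderiv alpha phi = fd 1 phi.
Proof.
move=> hn; apply/funext => x; rewrite /right_fracderiv /fd right_fracintE; last exact: C1c_meas hn.
have [h1 h2] := Vint_derivable hn (or_introl erefl) a1 x.
by rewrite /= derive1_cM// h2; ring.
Qed.

Lemma left_fracderivE phi a b C : C1c phi a b C -> left_fracderiv alpha phi = fd (-1) phi.
Proof.
move=> hn; apply/funext => x; rewrite /left_fracderiv /fd left_fracintE; last exact: C1c_meas hn.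
have [h1 h2] := Vint_derivable hn (or_intror erefl) a1 x.
by rewrite derive1_cM// h2; ring.
Qed.

(** [D k u x] compares u(x) with u(x - t), so looking to the right, s = 1, requires the reflected
    kernel. *)
Definition ks (s e t : R) : R := kn e (- s * t).

Lemma ks1 e : ks 1 e = fun t => kn e (- t).
Proof. by apply/funext => t; rewrite /ks mulN1r. Qed.

Lemma ksN1 e : ks (-1) e = kn e.
Proof. by apply/funext => t; rewrite /ks opprK mul1r. Qed.

Lemma kern_ks s e : s = 1 \/ s = -1 -> 0 < e -> kern (ks s e).
Proof.
move=> [->|->] e0.
- by rewrite ks1; apply: kern_refl; exact: kern_kn.
- by rewrite ksN1; exact: kern_kn.
Qed.

Lemma sqnorm_D_ks s e u : s = 1 \/ s = -1 -> 0 < e -> sqint u -> sqnorm (D (ks s e) u) = sqnorm (D (kn e) u).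
Proof.
move=> [->|->] e0 hu.
- by rewrite ks1; exact: D_norm_refl (kern_kn a0 e0) hu.
- by rewrite ksN1.
Qed.

Lemma ks_refl s e : (fun t => ks s e (- t)) = ks (- s) e.
Proof. by apply/funext => t; rewrite /ks; congr (kn _ _); ring. Qed.

Lemma D_ks_Dt s e phi x : s = 1 \/ s = -1 -> measurable_fun setT phi ->
  D (ks s e) phi x = Dt phi s alpha e x.
Proof.
move=> hs mphi; rewrite /D /Dt.
have hs' : - s = 1 \/ - s = -1 by case: hs => ->; [right|left; rewrite opprK].
have ss : s * s = 1 by case: hs => ->; rewrite ?mulr1 ?mulrNN ?mulr1.
rewrite -(Ri_affine 0 hs'); last first.
  apply: measurable_funM.
    have := measurable_comp_affine 0 (- s) (kn_meas alpha e).
    by under eq_fun do rewrite add0r.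
  apply: measurable_funB => //; apply: (measurableT_comp mphi); exact: measurable_funB.
apply: eq_Ri => t; rewrite /ks add0r mulrA mulrNN ss mul1r.
by rewrite mulNr opprK.
Qed.

(** The inverse of alpha / Gamma(1 - alpha), the normalizing constant in the Marchaud form of the
    fractional derivative. *)
Definition cst_fd : R := G / alpha.

Lemma cst_fd_gt0 : 0 < cst_fd. Proof. by rewrite divr_gt0// G_gt0. Qed.

Definition Kapp (C e : R) : R := C / alpha * (e `^ (1 - alpha) / (1 - alpha)).

Lemma D_ks_approx s e phi a b C x : C1c phi a b C -> s = 1 \/ s = -1 -> 0 < e -> e <= 1 ->
  `|D (ks s e) phi x - cst_fd * fd s phi x| <= if x \in `[a - 1, b + 1] then Kapp C e else 0.
Proof.
move=> hn hs e0 e1; rewrite D_ks_Dt//; last exact: C1c_meas hn.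
have -> : cst_fd * fd s phi x = - s / alpha * Vint s alpha (derive1 phi) x.
  by rewrite /cst_fd /fd; field; rewrite ?(gt_eqF G_gt0) ?(gt_eqF a0).
exact: (Dt_approx hn hs a0 a1).
Qed.

Lemma C1c_sq phi a b C : C1c phi a b C -> sqint phi.
Proof.
move=> hn; have mphi := C1c_meas hn; have [C' hC'] := C1c_bdd hn.
have [_ _ h0 _ _] := hn; split=> //.
apply: le_ib (ib_itv_cst a b (C' ^+ 2) true false); first exact: measurable_funX.
move=> x; rewrite in_itv/= ger0_norm ?sqr_ge0//.
have [xa|ax] := ltP x a; first by rewrite (h0 x _).1 ?expr0n//; left.
have [bx|xb] := ltP b x; first by rewrite (h0 x _).1 ?expr0n//; right.
by rewrite -(real_normK (num_real (phi x))) /= ler_pXn2r ?nnegrE// (le_trans _ (hC' x)).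
Qed.

Lemma Vint_meas s (f : R -> R) : measurable_fun setT f -> measurable_fun setT (Vint s alpha f).
Proof.
move=> mf.
apply: (measurable_Ri2 (F := fun z => if z.2 \in `]0, +oo[ then f (z.1 + s * z.2) * z.2 `^ (- alpha) else 0)).
apply: measurable_fun_ifT.
- under eq_fun do rewrite in_itv/= andbT; exact: measurable_fun_ltr.
- apply: measurable_funM.
    apply: (measurableT_comp mf); apply: measurable_funD => //; exact: measurable_funM.
  by apply: (measurableT_comp (f := fun t : R => t `^ (- alpha))); [exact: measurable_powR|].
- exact: measurable_cst.
Qed.

(** No decay estimate on [fd s phi], which need not have compact support, is made: its pairing with
    u is integrable because that of [D (ks s e) phi] is and the two differ, up to the constant, by a
    bounded function supported in [a - 1, b + 1]. *)
Lemma pair_approx s e u phi a b C : C1c phi a b C -> s = 1 \/ s = -1 -> 0 < e -> e <= 1 -> sqint u ->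
  ib (fun x => u x * fd s phi x) /\
  `|Ri (fun x => u x * D (ks s e) phi x) - cst_fd * Ri (fun x => u x * fd s phi x)|
    <= Kapp C e * Ri (fun x => if x \in `[a - 1, b + 1] then `|u x| else 0).
Proof.
move=> hn hs e0 e1 hu; have [mu_ iu] := hu; have c0 := cst_fd_gt0.
have hD : sqint (D (ks s e) phi) by apply: D_L2; [exact: kern_ks|exact: C1c_sq hn].
have i1 := sqint_mul hu hD.
have mfd : measurable_fun setT (fd s phi).
  by apply: measurable_funM => //; apply: Vint_meas; exact: C1c_meas1 hn.
pose E x := u x * (D (ks s e) phi x - cst_fd * fd s phi x).
have iab : ib (fun x => if x \in `[a - 1, b + 1] then `|u x| else 0).
  apply: le_ib (ibD (ib_itv_cst (a - 1) (b + 1) 1 true false) iu).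
    by apply: measurable_itv_if; exact: measurableT_comp.
  move=> x; case: ifP => _; last by rewrite normr0 add0r sqr_ge0.
  rewrite normr_id; have := sqr_ge0 (`|u x| - 1); have := normr_ge0 (u x).
  rewrite -(real_normK (num_real (u x))); lra.
have Ele x : `|E x| <= Kapp C e * (if x \in `[a - 1, b + 1] then `|u x| else 0).
  rewrite /E normrM mulrC; have := D_ks_approx x hn hs e0 e1.
  case: ifP => _ h; first by rewrite ler_wpM2r.
  by rewrite mulr0 -(mul0r `|u x|) ler_wpM2r.
have iE : ib E.
  apply: le_ib (ibZ (Kapp C e) iab) => //.
  apply: measurable_funM => //; apply: measurable_funB; first exact: hD.1.
  exact: measurable_funM.
have ifd : ib (fun x => u x * fd s phi x).
  apply: ib_ext (ibZ cst_fd^-1 (ibB i1 iE)) => x.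
  by rewrite /E; field; rewrite gt_eqF.
split=> //; rewrite -(RiZ _ ifd) -(RiB i1 (ibZ _ ifd)).
rewrite (@eq_Ri _ _ E); last by move=> x; rewrite /E; ring.
apply: le_trans (Ri_norm iE) _; rewrite -(RiZ _ iab).
by apply: le_Ri => //; [exact: ib_norm|exact: ibZ].
Qed.

End FracDeriv.

(** * Weak derivatives *)

Section WeakDeriv.
Context {R : realType}.
Local Notation mu := (@lebesgue_measure R).
Implicit Types phi u v g : R -> R.
Variable alpha : R.
Hypothesis a0 : 0 < alpha.
Hypothesis a1 : alpha < 1.
Local Notation kn := (kn alpha).
Local Notation ks := (ks alpha).
Local Notation c := (cst_fd alpha).
Local Notation eps := (fun n : nat => n.+1%:R^-1 : R).

Lemma eps_gt0 n : 0 < eps n. Proof. by rewrite invr_gt0. Qed.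

Lemma eps_le1 n : eps n <= 1. Proof. by rewrite invf_le1// ler1n. Qed.

Lemma eps_le n m : (n <= m)%N -> eps m <= eps n.
Proof. by move=> nm; rewrite lef_pV2 ?posrE// ler_nat. Qed.

(** For s = 1 the difference of kernels is reflected as a whole, which does not change the norm. *)
Lemma D_ks_mono s d e u : s = 1 \/ s = -1 -> 0 < d -> d <= e -> sqint u ->
  sqnorm (D (ks s e) u) + sqnorm (fun x => D (ks s d) u x - D (ks s e) u x) <= sqnorm (D (ks s d) u).
Proof.
move=> hs d0 de hu; have e0 := lt_le_trans d0 de.
have h := D_kn_mono a0 d0 de hu.
have diffE (k l : R -> R) : kern k -> kern l ->
    sqnorm (fun x => D k u x - D l u x) = sqnorm (D (fun t => k t - l t) u).
  move=> hk hl; apply: eq_Ri => x; congr (_ ^+ 2).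
  rewrite /D -(RiB (ib_D x hk hu) (ib_D x hl hu)).
  by apply: eq_Ri => t; ring.
have [hm _ _] := decr_kn_diff a0 d0 de.
have e1 := diffE _ _ (kern_ks a0 hs d0) (kern_ks a0 hs e0).
have e2 := diffE _ _ (kern_kn a0 d0) (kern_kn a0 e0).
have e3 : sqnorm (D (fun t => ks s d t - ks s e t) u) = sqnorm (D (fun t => kn d t - kn e t) u).
  have [s1|s1] := hs.
  - have e4 : (fun t => ks s d t - ks s e t) = (fun t => (fun t => kn d t - kn e t) (- t)).
      by apply/funext => t; rewrite s1 !ks1.
    exact: (etrans (congr1 (fun k => sqnorm (D k u)) e4) (D_norm_refl hm hu)).
  - have e4 : (fun t => ks s d t - ks s e t) = (fun t => kn d t - kn e t).
      by apply/funext => t; rewrite s1 !ksN1.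
    exact: (congr1 (fun k => sqnorm (D k u)) e4).
have eqle (A A' B B' C C' : R) : A = A' -> B = B' -> C = C' -> A' + B' <= C' -> A + B <= C.
  by move=> -> -> ->.
exact: (eqle _ _ _ _ _ _ (sqnorm_D_ks a0 hs e0 hu) (etrans e1 (etrans e3 (esym e2)))
  (sqnorm_D_ks a0 hs d0 hu) h).
Qed.

Lemma Kapp_cvg0 (C B : R) : Kapp alpha C (eps n) * B @[n --> \oo] --> 0.
Proof.
have h : (eps n) `^ (1 - alpha) @[n --> \oo] --> 0.
  have b0 : 0 < 1 - alpha by rewrite subr_gt0.
  have h := powRN_cvg0 b0.
  have hn : (n.+1%:R : R) @[n --> \oo] --> +oo.
    apply/cvgryPge => A; near=> n.
    apply: (@le_trans _ _ n%:R); last by rewrite ler_nat.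
    by near: n; exact: nbhs_infty_ger.
  have := @cvg_comp _ _ _ (fun n : nat => (n.+1%:R : R)) (fun t : R => t `^ (- (1 - alpha))) _ _ _ hn h.
  apply: cvg_trans; apply: near_eq_cvg; apply: nearW => n /=.
  by rewrite -powR_inv1// -powRrM mulN1r.
have -> : (fun n => Kapp alpha C (eps n) * B) = (fun n => (C / alpha / (1 - alpha) * B) * (eps n) `^ (1 - alpha)).
  by apply/funext => n; rewrite /Kapp; ring.
rewrite -(mulr0 (C / alpha / (1 - alpha) * B)); apply: cvgM; first exact: cvg_cst.
exact: h.
Unshelve. all: by end_near. Qed.

Lemma cvg0_le (d : R) (y : nat -> R) : (forall i, d <= y i) -> y @ \oo --> 0 -> d <= 0.
Proof.
move=> h hy; rewrite -(cvg_lim _ hy)//; apply: limr_ge; first by apply/cvg_ex; exists 0.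
exact: nearW.
Qed.

Lemma eq_of_norm_le (a b : R) : `|a - b| <= 0 -> a = b.
Proof. by rewrite normr_le0 subr_eq0 => /eqP. Qed.

Lemma D_ks_adjoint s e u phi : s = 1 \/ s = -1 -> 0 < e -> sqint u -> sqint phi ->
  Ri (fun x => D (ks (- s) e) u x * phi x) = Ri (fun x => u x * D (ks s e) phi x).
Proof.
move=> hs e0 hu hp.
have hs' : - s = 1 \/ - s = -1 by case: hs => ->; [right|left; rewrite opprK].
by rewrite (D_adjoint (kern_ks a0 hs' e0) hu hp) ks_refl opprK.
Qed.

(** Differences of u are taken in the direction -s, so that the adjoint falls on phi in the
    direction s. Their norms are bounded and increasing, and the pairing with phi passes to the L2
    limit. *)
Lemma weak_of_Gagliardo s u : s = 1 \/ s = -1 -> sqint u -> ib (fun r => W u r / wt alpha r) ->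
  exists v, sqint v /\ forall phi a b C, C1c phi a b C ->
    Ri (fun x => v x * phi x) = Ri (fun x => u x * fd alpha s phi x).
Proof.
move=> hs hu hW.
have hs' : - s = 1 \/ - s = -1 by case: hs => ->; [right|left; rewrite opprK].
pose g n := D (ks (- s) (eps n)) u.
have hg n : sqint (g n) by apply: D_L2 => //; exact: (kern_ks a0 hs' (eps_gt0 n)).
have g1 n m : (n <= m)%N -> sqnorm (fun x => g m x - g n x) <= sqnorm (g m) - sqnorm (g n).
  move=> nm; rewrite lerBrDl; exact: D_ks_mono (eps_gt0 m) (eps_le nm) hu.
have g2 n : sqnorm (g n) <= 2^-1 * (Ckap alpha * Ri (fun r => W u r / wt alpha r)).
  rewrite /g (sqnorm_D_ks a0 hs' (eps_gt0 n) hu); exact: (D_kn_bounded a0 a1 hu hW (eps_gt0 n)).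
have [w [hw [si [hsi hwg]]]] := L2_complete hg g1 g2.
have c0 := cst_fd_gt0 a0 a1.
exists (fun x => c^-1 * w x); split; first exact: sqintZ.
move=> phi a b C hn; have hp := C1c_sq hn.
have iwp := sqint_mul hw hp.
rewrite (@eq_Ri _ _ (fun x => c^-1 * (w x * phi x))); last by move=> x; rewrite mulrA.
rewrite (RiZ _ iwp).
suff -> : Ri (fun x => w x * phi x) = c * Ri (fun x => u x * fd alpha s phi x).
  by rewrite mulKf// gt_eqF.
apply: eq_of_norm_le.
pose B := Ri (fun x => if x \in `[a - 1, b + 1] then `|u x| else 0).
have B0 : 0 <= B by apply: Ri_ge0 => x; case: ifP.
have C0 : 0 <= C by case: hn.
have KC e : 0 <= Kapp alpha C e.
  by rewrite /Kapp mulr_ge0 ?divr_ge0 ?powR_ge0// ?subr_ge0 ltW.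
(* The first term is Cauchy-Schwarz for the distance to the L2 limit, the second the truncation
   error on phi; since si i >= i, the latter may be stated at level i. *)
apply: (@cvg0_le _ (fun i => Num.sqrt (8^-1 ^+ i * sqnorm phi) + Kapp alpha C (eps i) * B)); last first.
  rewrite -(addr0 0); apply: cvgD; last exact: Kapp_cvg0.
  rewrite -(sqrtr0 R); apply: (continuous_cvg _ (@sqrt_continuous R _)).
  rewrite -(mul0r (sqnorm phi)); apply: cvgM; last exact: cvg_cst.
  by apply: cvg_expr; rewrite ger0_norm// invf_lt1// ltr1n.
move=> i.
have [ifd h] := pair_approx a0 a1 hn hs (eps_gt0 (si i)) (eps_le1 (si i)) hu.
rewrite -(D_ks_adjoint hs (eps_gt0 (si i)) hu hp) -/(g (si i)) in h.
have igp := sqint_mul (hg (si i)) hp.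
have h1 : `|Ri (fun x => w x * phi x) - Ri (fun x => g (si i) x * phi x)| <= Num.sqrt (8^-1 ^+ i * sqnorm phi).
  have hd := sqintB hw (hg (si i)).
  rewrite -(RiB iwp igp) (@eq_Ri _ _ (fun x => (w x - g (si i) x) * phi x)); last by move=> x; ring.
  rewrite -sqrtr_sqr ler_wsqrtr//.
  apply: le_trans (Ri_Cauchy_Schwarz hd.1 hp.1 hd.2 hp.2) _.
  by rewrite ler_wpM2r ?sqnorm_ge0//; exact: hwg.
have h2 : Kapp alpha C (eps (si i)) * B <= Kapp alpha C (eps i) * B.
  rewrite ler_wpM2r// /Kapp ler_wpM2l ?divr_ge0 ?(ltW a0)//.
  rewrite ler_wpM2r ?invr_ge0 ?subr_ge0 ?(ltW a1)//.
  apply: ge0_ler_powR; rewrite ?nnegrE ?subr_ge0 ?(ltW a1) ?(ltW (eps_gt0 _))//.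
  exact: eps_le.
rewrite -(subrK (Ri (fun x => g (si i) x * phi x)) (Ri (fun x => w x * phi x))) -addrA.
apply: le_trans (ler_normD _ _) _; apply: lerD => //.
exact: le_trans h h2.
Qed.

(** The height bound K (j+1) on a support of length 1/(j+1) is what Lebesgue points need. C may
    depend on j but not on y, so that errors can be integrated over y; z -> eta j (y - z) is the
    test function whose pairing with f is the convolution at y. *)
Definition mollifier (eta : nat -> R -> R) (K : R) : Prop := forall j,
  [/\ forall t, 0 <= eta j t, forall t, eta j t <= K * j.+1%:R,
      forall t, t < 0 \/ eps j < t -> eta j t = 0, Ri (eta j) = 1 &
      exists C, forall y, C1c (fun z => eta j (y - z)) (y - eps j) y C /\
        test_function (fun z => eta j (y - z))].

(** * Mollification and Lebesgue points *)

Section Mollify.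
Variables (eta : nat -> R -> R) (K : R).
Hypothesis hm : mollifier eta K.

Lemma eta_meas j : measurable_fun setT (eta j).
Proof.
have [_ _ _ _ [C hC]] := hm j; have [hn _] := hC 0.
have h := measurable_comp_affine 0 (-1) (C1c_meas hn).
have -> // : eta j = fun x => eta j (0 - (0 + -1 * x)).
by apply/funext => x; congr (eta j _); ring.
Qed.

Lemma eta_supp j t : 0 <= eta j t <= if t \in `[0, eps j] then K * j.+1%:R else 0.
Proof.
have [e0 eK es _ _] := hm j; rewrite e0 in_itv/=.
have [t0|t0] := ltP t 0; first by rewrite es//; left.
by have [t1|t1] := ltP (eps j) t; first by rewrite es//; right.
Qed.

Lemma eta_kern j : kern (eta j).
Proof.
have [e0 eK es _ _] := hm j; split=> //; last by exists (K * j.+1%:R).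
apply: le_ib (eta_meas j) _ (ib_itv_cst 0 (eps j) (K * j.+1%:R) true false) => t.
by rewrite ger0_norm//; have /andP[] := eta_supp j t.
Qed.

Definition conv j f y : R := Ri (fun z => f z * eta j (y - z)).

Lemma convE j f y : measurable_fun setT f -> conv j f y = Ri (fun t => eta j t * f (y - t)).
Proof.
move=> mf; rewrite /conv -[RHS](Ri_refl y); last first.
  apply: measurable_funM; first exact: eta_meas.
  by apply: (measurableT_comp mf); exact: measurable_funB.
by apply: eq_Ri => z; rewrite subKr mulrC.
Qed.

(** Young's inequality with total mass 1, as a case of the Schur test. *)
Lemma conv_L2 j f : sqint f -> sqint (conv j f) /\ sqnorm (conv j f) <= sqnorm f.
Proof.
move=> hf; have [_ _ _ e1 _] := hm j.
have -> : conv j f = fun y => Ri (fun t => eta j t * f (y - t)).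
  by apply/funext => y; apply: convE; exact: hf.1.
have := @kern_L2 R (eta j) (fun z => f (z.1 - z.2)) (sqnorm f) (eta_kern j).
rewrite e1 expr1n mul1r; apply.
- by apply: (measurableT_comp hf.1); exact: measurable_funB.
- by move=> x; exact: (kern_ib_sqr (eta_kern j) (sqint_refl x hf)).
- move=> t; split; first exact: (sqint_shift (- t) hf).2.
  by have := sqnorm_shift (- t) hf; rewrite /sqnorm /= => ->.
Qed.

Lemma conv_D j k u y : kern k -> sqint u -> conv j (D k u) y = D k (conv j u) y.
Proof.
move=> hk hu; have he := kern_sq (eta_kern j).
have [_ e] := D_pair hk hu (sqint_refl y he).
rewrite /conv e /D; apply: eq_Ri => t; congr (_ * _).
have i1 := sqint_mul hu (sqint_refl y he).
have i2 := sqint_mul (sqint_shift (- t) hu) (sqint_refl y he).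
rewrite (@eq_Ri _ _ (fun x => u x * eta j (y - x) - u (x - t) * eta j (y - x))); last by move=> x; ring.
rewrite (RiB i1 i2); congr (_ - _).
rewrite -(Ri_shift t (ib_meas i2)); apply: eq_Ri => x.
by rewrite addrK; congr (_ * eta j _); ring.
Qed.

(** A sliding window is convolution with the indicator of [-q, p]. This makes the local integrals of
    |u| in the truncation error square integrable in the centre y. *)
Lemma box_L2 (p q : R) u : sqint u -> sqint (fun y => Ri (fun x => if x \in `[y - p, y + q] then `|u x| else 0)).
Proof.
move=> hu; pose k (t : R) : R := if t \in `[- q, p] then 1 else 0.
have hk : kern k.
  split; first exact: ib_itv_cst; first by move=> t; rewrite /k; case: ifP.
  by exists 1 => t; rewrite /k; case: ifP.
have mn : measurable_fun setT (fun x => `|u x|) by apply: measurableT_comp => //; exact: hu.1.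
have -> : (fun y => Ri (fun x => if x \in `[y - p, y + q] then `|u x| else 0)) =
    fun y => Ri (fun t => k t * `|u (y - t)|).
  apply/funext => y; rewrite -[LHS](Ri_refl y); last exact: measurable_itv_if.
  apply: eq_Ri => t; rewrite /k !in_itv/=.
  have -> : (y - p <= y - t <= y + q) = (- q <= t <= p) by apply/idP/idP; lra.
  by case: ifP; rewrite ?mul1r ?mul0r.
apply: (kern_L2 (F := fun z => `|u (z.1 - z.2)|) (B := sqnorm u) hk _ _ _).1.
- by apply: (measurableT_comp mn); exact: measurable_funB.
- move=> x; apply: ib_ext (kern_ib_sqr hk (sqint_refl x hu)) => t.
  by rewrite /= real_normK ?num_real.
- move=> t /=; under eq_fun do rewrite real_normK ?num_real//.
  split; first exact: (sqint_shift (- t) hu).2.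
  by have := sqnorm_shift (- t) hu; rewrite /sqnorm /= => ->.
Qed.

(** At each y, testing against the mollifier centred there puts the mollified difference within
    [Kapp] times a window integral of |u| from c times the mollified v. The factor 2 is the cost of
    splitting off that error in squared norm; only a bound independent of n and j matters. *)
Lemma conv_bound s u v n j : s = 1 \/ s = -1 -> sqint u -> sqint v ->
  (forall phi, test_function phi -> Ri (fun x => v x * phi x) = Ri (fun x => u x * fd alpha s phi x)) ->
  sqnorm (conv j (D (ks (- s) (eps n)) u)) <= 2 * (c ^+ 2 * sqnorm v).
Proof.
move=> hs hu hv hw.
have hs' : - s = 1 \/ - s = -1 by case: hs => ->; [right|left; rewrite opprK].
have [_ _ _ _ [C hC]] := hm j.
have C0 : 0 <= C by have [[]] := hC 0.
have KC e : 0 <= Kapp alpha C e.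
  by rewrite /Kapp mulr_ge0 ?divr_ge0 ?powR_ge0// ?subr_ge0 ltW.
pose b y := Ri (fun x => if x \in `[y - eps j - 1, y + 1] then `|u x| else 0).
have hb : sqint b.
  have := box_L2 (eps j + 1) 1 hu; rewrite /b.
  by under eq_fun do rewrite opprD addrA.
have [hcu _] := conv_L2 j hu; have [hcv cvle] := conv_L2 j hv.
have hDm m : kern (ks (- s) (eps m)) by exact: (kern_ks a0 hs' (eps_gt0 m)).
have cE m : conv j (D (ks (- s) (eps m)) u) = D (ks (- s) (eps m)) (conv j u).
  by apply/funext => y; exact: conv_D.
have approx m y : `|conv j (D (ks (- s) (eps m)) u) y - c * conv j v y| <= Kapp alpha C (eps m) * b y.
  have [hn ht] := hC y; have hp := C1c_sq hn.
  have [ifd h] := pair_approx a0 a1 hn hs (eps_gt0 m) (eps_le1 m) hu.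
  by rewrite /conv (hw _ ht) (D_ks_adjoint hs (eps_gt0 m) hu hp).
have hcm m : sqint (conv j (D (ks (- s) (eps m)) u)) by apply: (conv_L2 j _).1; exact: D_L2.
rewrite -subr_le0.
(* The norm at level n is at most that at level m + n, where the truncation error tends to 0 with
   m. *)
apply: (@cvg0_le _ (fun m => 2 * ((Kapp alpha C (eps (m + n)%N) * 1) ^+ 2 * sqnorm b))); last first.
  have h0 := Kapp_cvg0 C 1.
  have h : Kapp alpha C (eps (m + n)%N) * 1 @[m --> \oo] --> 0.
    by rewrite (cvg_shiftn n (fun m => Kapp alpha C (eps m) * 1)).
  have -> : (0 : R) = 2 * ((0 * 0) * sqnorm b) by rewrite !mul0r mulr0.
  apply: cvgM; first exact: cvg_cst.
  apply: cvgM; last exact: cvg_cst.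
  by under eq_fun do rewrite expr2; exact: cvgM.
move=> m; rewrite lerBlDl mulr1.
have le_of_add (A A' B B' C' : R) : A = A' -> B = B' -> 0 <= C' -> A' + C' <= B' -> A <= B.
  by move=> -> -> h; apply: le_trans; rewrite lerDl.
have h3 := D_ks_mono hs' (eps_gt0 (m + n)%N) (eps_le (leq_addl m n)) hcu.
apply: (le_trans (le_of_add _ _ _ _ _ (congr1 sqnorm (cE n)) (congr1 sqnorm (cE (m + n)%N)) (sqnorm_ge0 _) h3)).
set f := conv j _; pose d x := f x - c * conv j v x.
have hd : sqint d by apply: sqintB; [exact: hcm|exact: sqintZ].
have -> : sqnorm f = sqnorm (fun x => c * conv j v x + d x).
  by apply: eq_Ri => x; rewrite /d addrC subrK.
apply: le_trans (sqnormD_le (sqintZ c hcv) hd) _.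
rewrite (sqnormZ _ hcv); apply: lerD; rewrite ler_wpM2l//.
  by rewrite ler_wpM2l ?sqr_ge0.
rewrite -(sqnormZ _ hb); apply: le_Ri; [exact: hd.2|exact: (sqintZ _ hb).2|].
move=> x; rewrite -(real_normK (num_real (d x))) ler_pXn2r ?nnegrE//.
- exact: approx.
- by rewrite mulr_ge0// Ri_ge0// => z; case: ifP.
Qed.

(** At a Lebesgue point y, the error is at most K (j+1) times the integral of |g - g(y)| over a ball
    of radius 2/(j+1), that is 4 K times its average. *)
Lemma conv_cvg g : sqint g -> {ae mu, forall y, conv j g y @[j --> \oo] --> g y}.
Proof.
move=> hg; have [mg _] := hg.
have lg := sqint_locally_integrable hg.
apply: ae_imp (lebesgue_differentiation lg) => y hy.
(* Twice the length of the support, so that the open ball contains the closed interval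
   [y - 1/(j+1), y]. *)
pose r j : R := 2 * eps j.
have r0 j : 0 < r j by rewrite mulr_gt0// eps_gt0.
have K0 : 0 <= K.
  have [_ h _ _ _] := hm 0%N; have /andP[h1 _] := eta_supp 0 0.
  by have := le_trans h1 (h 0); rewrite mulr1.
pose J j : R := Ri (fun z => if z \in `]y - r j, y + r j[ then `|g z - g y| else 0).
have iJ j : ib (fun z => if z \in `]y - r j, y + r j[ then `|g z - g y| else 0).
  have h := ibD (ib_itv_cst (y - r j) (y + r j) (1 + `|g y|) false true) hg.2.
  apply: le_ib h.
    by apply: measurable_itv_if; apply: measurableT_comp => //; exact: measurable_funB.
  move=> z; case: ifP => _; last by rewrite normr0 add0r sqr_ge0.
  rewrite normr_id; have := ler_normB (g z) (g y); have := sqr_ge0 (`|g z| - 1).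
  have := normr_ge0 (g z); rewrite -(real_normK (num_real (g z))); lra.
have davgE j : davg g y (r j) = ((j.+1%:R / 4) * J j)%:E.
  rewrite /davg /iavg lebesgue_measure_ball ?(ltW (r0 j))// inver mulrn_eq0 /= gt_eqF//.
  rewrite EFinM; congr (_ * _)%E.
    by congr EFin; rewrite /r; field.
  by rewrite ball_itv -(Ri_E (iJ j)) ge0_integral_itv.
have rc : r j @[j --> \oo] --> 0^'+.
  have hr : r j @[j --> \oo] --> 0.
    rewrite -(mulr0 2); apply: cvgM; first exact: cvg_cst.
    apply/cvgrPdist_lt => e e0; near=> j.
    rewrite sub0r normrN (ger0_norm (ltW (eps_gt0 j))); near: j.
    exact: (near_infty_natSinv_lt (PosNum e0)).
  move=> A hA; exact: (@filterS _ \oo _ _ _ (fun j (h : 0 < r j -> A (r j)) => h (r0 j)) (hr _ hA)).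
have c1 : davg g y (r j) @[j --> \oo] --> 0%E by exact: (cvg_comp _ _ rc hy).
have c2 : (j.+1%:R / 4) * J j @[j --> \oo] --> 0.
  have -> : (fun j : nat => (j.+1%:R / 4) * J j) = fine \o (fun j => davg g y (r j)).
    by apply/funext => j; rewrite /= davgE.
  exact: (fine_cvg c1).
have c3 : 4 * K * ((j.+1%:R / 4) * J j) @[j --> \oo] --> 0.
  by rewrite -(mulr0 (4 * K)); apply: cvgM; [exact: cvg_cst|exact: c2].
apply/subr_cvg0; apply: norm_cvg0.
apply: (squeeze_cvgr _ (cvg_cst 0) c3); apply: nearW => j; rewrite normr_ge0 /=.
have [e0 eK es e1 _] := hm j.
have he := kern_sq (eta_kern j).
have ie : ib (fun z => eta j (y - z)) by apply: ib_refl; have [] := eta_kern j.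
have i1 := sqint_mul hg (sqint_refl y he).
have i2 := ibZ (g y) ie.
have -> : conv j g y - g y = Ri (fun z => g z * eta j (y - z) - g y * eta j (y - z)).
  by rewrite (RiB i1 i2) (RiZ _ ie) (Ri_refl y (eta_meas j)) e1 mulr1.
have i3 := ibB i1 i2.
apply: le_trans (Ri_norm i3) _.
have -> : 4 * K * (j.+1%:R / 4 * J j) = K * j.+1%:R * J j by field.
rewrite -(RiZ _ (iJ j)); apply: le_Ri; [exact: ib_norm|exact: ibZ|] => z.
rewrite -mulrBl normrM mulrC.
have /andP[ge0 le1] := eta_supp j (y - z).
rewrite (ger0_norm ge0); case: ifPn => hz.
  by rewrite ler_wpM2r.
rewrite es ?mul0r ?mulr0//.
have ej := r0 j; move: hz; rewrite in_itv/= negb_and -!leNgt.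
have -> : eps j = r j / 2 by rewrite /r mulrC mulKf.
by case/orP => hz; [right|left]; lra.
Unshelve. all: by end_near. Qed.

Lemma Gagliardo_of_weak s u v : s = 1 \/ s = -1 -> sqint u -> sqint v ->
  (forall phi, test_function phi -> Ri (fun x => v x * phi x) = Ri (fun x => u x * fd alpha s phi x)) ->
  ib (fun r => W u r / wt alpha r).
Proof.
move=> hs hu hv hw.
have hs' : - s = 1 \/ - s = -1 by case: hs => ->; [right|left; rewrite opprK].
apply: (bounded_D_kn a0 (M := 2 * (c ^+ 2 * sqnorm v)) hu) => n.
rewrite -(sqnorm_D_ks a0 hs' (eps_gt0 n) hu).
have hg : sqint (D (ks (- s) (eps n)) u) by apply: D_L2 => //; exact: (kern_ks a0 hs' (eps_gt0 n)).
apply: (Ri_Fatou (f_ := fun j x => conv j (D (ks (- s) (eps n)) u) x ^+ 2) _ _ _ _ _ _).2.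
- by move=> j; exact: (conv_L2 j hg).1.2.
- by move=> j x; exact: sqr_ge0.
- by move=> j; exact: conv_bound hs hu hv hw.
- exact: measurable_funX hg.1.
- by move=> x; exact: sqr_ge0.
- apply: ae_imp (conv_cvg hg) => y hy.
  by rewrite expr2; under eq_fun do rewrite expr2; exact: cvgM.
Qed.

End Mollify.
End WeakDeriv.

(** * A smooth mollifier *)

Section Bump.
Context {R : realType}.

Lemma exprn_le_expR (k : nat) (y : R) : 0 <= y -> y ^+ k <= k`!%:R * expR y.
Proof.
case: k => [|k] y0; first by rewrite expr0 fact0 mul1r (le_trans _ (expR_ge1Dx y))// lerDl.
have := expR_ge1Dxn k y0.
have f0 : (0 : R) < k.+1`!%:R by rewrite ltr0n fact_gt0.
rewrite -ler_pdivrMl// mulrC; apply: le_trans.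
by rewrite lerDr.
Qed.

(** The exponent k stays general because peeling a factor X off the polynomial raises it by one. *)
Lemma poly_le_expR (p : {poly R}) : forall k : nat, exists C, forall y, 0 <= y ->
  `|p.[y]| * y ^+ k <= C * expR y.
Proof.
elim/poly_ind: p => [|p c ih] k.
  by exists 0 => y y0; rewrite horner0 normr0 !mul0r.
have [C hC] := ih k.+1.
exists (C + `|c| * k`!%:R) => y y0.
rewrite hornerMXaddC (@le_trans _ _ ((`|p.[y]| * y + `|c|) * y ^+ k))//.
  rewrite ler_wpM2r ?exprn_ge0// (le_trans (ler_normD _ _))// lerD2r normrM.
  by rewrite (ger0_norm y0).
rewrite mulrDl mulrDl -mulrA -exprS lerD ?hC//.
by rewrite -mulrA ler_wpM2l// exprn_le_expR.
Qed.

(** The functions p(1/x) exp(-1/x), extended by 0: the form taken by all derivatives of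
    exp(-1/x). *)
Definition fl (p : {poly R}) (x : R) : R := if 0 < x then p.[x^-1] * expR (- x^-1) else 0.

(** For y = 1/x the claim is |p(y)| y^2 <= C exp y. A quadratic bound is enough to make the
    derivative at 0 vanish. *)
Lemma fl_sqr (p : {poly R}) : exists C, forall x, `|fl p x| <= C * x ^+ 2.
Proof.
have [C hC] := poly_le_expR p 2.
have C0 : 0 <= C by have := hC 0 (lexx _); rewrite expr0n mulr0 expR0 mulr1.
exists C => x; rewrite /fl; case: ifPn => [x0|_]; last by rewrite normr0 mulr_ge0 ?sqr_ge0.
have y0 : 0 <= x^-1 by rewrite invr_ge0 ltW.
rewrite normrM (ger0_norm (expR_ge0 _)) expRN ler_pdivrMr ?expR_gt0//.
rewrite mulrAC -ler_pdivrMr ?exprn_gt0// -exprVn; exact: hC.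
Qed.

Lemma is_derive0_sqr (f : R -> R) (C : R) : (forall x, `|f x| <= C * x ^+ 2) ->
  is_derive (0 : R) 1 f 0.
Proof.
move=> hf.
have f0 : f 0 = 0 by apply/eqP; have := hf 0; rewrite expr0n mulr0 normr_le0.
have c : h^-1 *: ((f \o shift 0) (h *: (1 : R)) - f 0) @[h --> (0 : R)^'] --> (0 : R).
  have c2 : C * `|h| @[h --> (0 : R)^'] --> (0 : R).
    have h1 : `|h| @[h --> (0 : R)^'] --> `|(0 : R)|.
      apply: cvg_norm; apply: cvg_within_filter; exact: cvg_id.
    have h2 : C * `|h| @[h --> (0 : R)^'] --> C * `|(0 : R)|.
      by apply: cvgM; [exact: cvg_cst|exact: h1].
    by move: h2; rewrite normr0 mulr0.
  apply: norm_cvg0; apply: (squeeze_cvgr _ (cvg_cst 0) c2).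
  near=> h; rewrite normr_ge0 /= f0 subr0 addr0 [h *: 1]mulr1.
  have h0 : h != 0 by near: h; exact: nbhs_dnbhs_neq.
  rewrite normrM normfV mulrC ler_pdivrMr ?normr_gt0// -mulrA -expr2.
  by rewrite real_normK ?num_real.
apply: DeriveDef; first by apply/cvg_ex; exists 0.
by apply/cvg_lim.
Unshelve. all: by end_near. Qed.

(** With y = 1/x the derivative of p(y) exp(-y) in y is (p' - p)(y) exp(-y), and dy/dx = -y^2. *)
Definition dfl (p : {poly R}) : {poly R} := 'X^2 * (p - p^`()).

Lemma is_derive_fl (p : {poly R}) (x : R) : is_derive x 1 (fl p) (fl (dfl p) x).
Proof.
have [x0|x0|->] := ltgtP x 0.
- have -> : fl (dfl p) x = 0 by rewrite /fl ltNge (ltW x0).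
  apply: (@near_eq_is_derive _ _ _ (cst 0)).
    near=> y; rewrite /fl ltNge (_ : y <= 0)//.
    by apply: ltW; near: y; exact: lt_nbhsl.
- have xn0 : x != 0 by rewrite gt_eqF.
  have h1 : is_derive x 1 (fun y : R => y^-1) (- (x ^- 2)).
    have := @is_deriveV R (fun y : R => y) x 1 1 xn0 (is_derive_id x 1).
    by move=> h; apply: is_derive_eq h _; rewrite /GRing.scale/= mulr1.
  have h2 := @is_derive1_comp R (fun y => p.[y]) (fun y : R => y^-1) x _ _ (is_derive_poly p x^-1) h1.
  have h3 := @is_derive1_comp R (@expR R) (fun y : R => - y^-1) x _ _ (is_derive_expR (- x^-1)) (is_deriveN h1).
  have h4 := is_deriveM h2 h3.
  apply: (@near_eq_is_derive _ _ _ ((fun y => p.[y^-1]) * (fun y => expR (- y^-1)))).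
    by near=> y; rewrite /fl ifT//; near: y; exact: lt_nbhsr.
  apply: (is_derive_eq h4).
  rewrite /fl x0 /dfl !hornerE /GRing.scale /=.
  by field.
- have [C hC] := fl_sqr p.
  have -> : fl (dfl p) 0 = 0 by rewrite /fl ltxx.
  exact: is_derive0_sqr hC.
Unshelve. all: by end_near. Qed.

Lemma flZ (c : R) (p : {poly R}) x : fl (c *: p) x = c * fl p x.
Proof. by rewrite /fl; case: ifP => _; rewrite ?mulr0// hornerZ mulrA. Qed.

(* Finite sums of products of two such functions of the affine arguments
   [m x + b] and [1 - (m x + b)]; they are closed under derivation. *)
Definition bterm (m b : R) (pq : {poly R} * {poly R}) (x : R) : R :=
  fl pq.1 (m * x + b) * fl pq.2 (1 - (m * x + b)).

Definition bsum (m b : R) (l : seq ({poly R} * {poly R})) (x : R) : R :=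
  \sum_(pq <- l) bterm m b pq x.

Definition dbsum (m : R) (l : seq ({poly R} * {poly R})) :=
  flatten [seq [:: (m *: dfl pq.1, pq.2); (pq.1, - m *: dfl pq.2)] | pq <- l].

Lemma is_derive_affine (m b x : R) : is_derive x 1 (fun x : R => m * x + b) m.
Proof.
have h := is_deriveD (is_deriveZ m (is_derive_id x 1)) (is_derive_cst b x 1).
by apply: is_derive_eq h _; rewrite addr0 /GRing.scale /= mulr1.
Qed.

Lemma is_derive_bterm (m b : R) pq (x : R) : is_derive x 1 (bterm m b pq)
  (bterm m b (m *: dfl pq.1, pq.2) x + bterm m b (pq.1, - m *: dfl pq.2) x).
Proof.
have h1 := @is_derive1_comp R (fl pq.1) (fun x : R => m * x + b) x _ _
  (is_derive_fl pq.1 (m * x + b)) (is_derive_affine m b x).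
have hB : is_derive x 1 (fun x : R => 1 - (m * x + b)) (- m).
  have h := is_deriveB (is_derive_cst (1 : R) x 1) (is_derive_affine m b x).
  by apply: is_derive_eq h _; rewrite sub0r.
have h2 := @is_derive1_comp R (fl pq.2) (fun x : R => 1 - (m * x + b)) x _ _
  (is_derive_fl pq.2 (1 - (m * x + b))) hB.
have h3 := is_deriveM h1 h2.
apply: (is_derive_eq h3); rewrite /bterm /= !flZ /GRing.scale /=.
ring.
Qed.

Lemma is_derive_bsum (m b : R) l (x : R) : is_derive x 1 (bsum m b l) (bsum m b (dbsum m l) x).
Proof.
elim: l => [|pq l ih].
  have -> : bsum m b [::] = cst 0 by apply/funext => y; rewrite /bsum big_nil.
  exact: is_derive_cst.
have -> : bsum m b (pq :: l) = bterm m b pq + bsum m b l.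
  by apply/funext => y; rewrite /bsum big_cons.
have h := is_deriveD (is_derive_bterm m b pq x) ih.
apply: (is_derive_eq h).
by rewrite /bsum /dbsum /= !big_cons addrA.
Qed.

Lemma derive1_bsum m b l : derive1 (bsum m b l) = bsum m b (dbsum m l).
Proof.
by apply/funext => x; rewrite derive1E; have [_ ->] := is_derive_bsum m b l x.
Qed.

Lemma derive1n_bsum m b l n : derive1n n (bsum m b l) = bsum m b (iter n (dbsum m) l).
Proof. by elim: n => [//|n ih]; rewrite derive1nS ih derive1_bsum. Qed.

Lemma bsum_smooth (m b : R) l n (x : R) : derivable (derive1n n (bsum m b l)) x 1.
Proof. by rewrite derive1n_bsum; have [] := is_derive_bsum m b (iter n (dbsum m) l) x. Qed.

Definition psi (t : R) : R := fl 1 t * fl 1 (1 - t).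

Lemma fl1_ge0 t : 0 <= fl 1 t.
Proof. by rewrite /fl; case: ifP => // _; rewrite hornerC mul1r expR_ge0. Qed.

Lemma fl1_le1 t : fl 1 t <= 1.
Proof.
rewrite /fl; case: ifP => // t0; rewrite hornerC mul1r expR_le1 oppr_le0 invr_ge0.
exact: ltW.
Qed.

Lemma psi_ge0 t : 0 <= psi t. Proof. by rewrite mulr_ge0// fl1_ge0. Qed.

Lemma psi_le1 t : psi t <= 1.
Proof. by rewrite mulr_ile1 ?fl1_ge0 ?fl1_le1. Qed.

Lemma psi_supp t : t < 0 \/ 1 < t -> psi t = 0.
Proof.
case=> ht; rewrite /psi /fl; first by rewrite ltNge (ltW ht) /= mul0r.
by rewrite [X in _ * X](_ : _ = 0) ?mulr0// ltNge ltW ?subr_lt0.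
Qed.

Lemma fl1_lb t : 4^-1 <= t -> expR (- 4) <= fl 1 t.
Proof.
move=> ht; have t0 : 0 < t by apply: lt_le_trans ht; rewrite invr_gt0.
rewrite /fl t0 hornerC mul1r ler_expR lerN2 invf_ple ?posrE//.
Qed.

Lemma psi_lb t : 4^-1 <= t -> t <= 3 / 4 -> expR (- 4) * expR (- 4) <= psi t.
Proof.
move=> h1 h2; apply: ler_pM; [exact: expR_ge0|exact: expR_ge0|exact: fl1_lb|].
by apply: fl1_lb; lra.
Qed.

Definition npsi (j : nat) : R := Ri (fun t => psi (j.+1%:R * t)).
Definition eta (j : nat) (t : R) : R := (npsi j)^-1 * psi (j.+1%:R * t).
(** On [1/4, 3/4] both factors of [psi] are at least exp(-4), so [npsi j] is at least exp(-4)^2 / (2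
    (j+1)); since [psi] is at most 1, the height of [eta j] is at most [Keta] (j+1). *)
Definition Keta : R := 2 * (expR (- 4) * expR (- 4))^-1.

Lemma psi_meas (j : nat) : measurable_fun setT (fun t : R => psi (j.+1%:R * t)).
Proof.
apply: continuous_measurable_fun => t; apply: derivable_continuous.
have -> : (fun t : R => psi (j.+1%:R * t)) = bsum j.+1%:R 0 [:: (1, 1)].
  by apply/funext => y; rewrite /bsum big_seq1 /bterm /psi addr0.
by have [] := is_derive_bsum j.+1%:R 0 [:: (1, 1)] t.
Qed.

Lemma ib_psi (j : nat) : ib (fun t : R => psi (j.+1%:R * t)).
Proof.
have j0 : 0 < j.+1%:R :> R by [].
apply: le_ib (psi_meas j) _ (ib_itv_cst 0 (j.+1%:R^-1) 1 true false) => t.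
rewrite ger0_norm ?psi_ge0// in_itv/=.
have [t0|t0] := ltP t 0; first by rewrite psi_supp//; left; rewrite pmulr_rlt0.
have [t1|t1] := leP t j.+1%:R^-1; first exact: psi_le1.
by rewrite psi_supp//; right; rewrite mulrC -ltr_pdivrMr// div1r.
Qed.

Lemma npsi_lb (j : nat) : expR (- 4) * expR (- 4) / (2 * j.+1%:R) <= npsi j.
Proof.
have j0 : 0 < j.+1%:R :> R by [].
pose a := (4 * j.+1%:R)^-1 : R; pose b := 3 * (4 * j.+1%:R)^-1 : R.
have a0 : 0 < a by rewrite invr_gt0 mulr_gt0.
have ab : a < b by rewrite /b -/a; lra.
have -> : expR (- 4) * expR (- 4) / (2 * j.+1%:R) = (expR (- 4) * expR (- 4)) * (b - a) :> R.
  rewrite /a /b; move: (j.+1%:R : R) j0 => J j0; field.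
  by rewrite gt_eqF.
rewrite -(@Ri_itv_cst R a b _ true false ab).
apply: le_Ri; [exact: ib_itv_cst|exact: ib_psi|] => t.
case: ifPn => [|_]; last exact: psi_ge0.
have ja : j.+1%:R * a = 4^-1.
  by rewrite /a; move: (j.+1%:R : R) j0 => J j0; field; rewrite gt_eqF.
have jb : j.+1%:R * b = 3 / 4.
  by rewrite /b; move: (j.+1%:R : R) j0 => J j0; field; rewrite gt_eqF.
rewrite in_itv/= => /andP[h1 h2]; apply: psi_lb.
- by rewrite -ja ler_pM2l.
- by rewrite -jb ler_pM2l.
Qed.

Lemma npsi_gt0 j : 0 < npsi j.
Proof. by apply: lt_le_trans (npsi_lb j); rewrite !mulr_gt0 ?invr_gt0 ?expR_gt0. Qed.

Lemma eta_bsum j y : (fun z => eta j (y - z)) =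
  bsum (- j.+1%:R) (j.+1%:R * y) [:: ((npsi j)^-1 *: 1, 1)].
Proof.
apply/funext => z; rewrite /bsum big_seq1 /bterm /= flZ /eta /psi mulrA.
by congr (_ * fl 1 _ * fl 1 _); ring.
Qed.

Lemma eta_supp0 j t : t < 0 \/ j.+1%:R^-1 < t -> eta j t = 0.
Proof.
move=> ht; rewrite /eta psi_supp ?mulr0//.
have j0 : 0 < j.+1%:R :> R by [].
case: ht => ht; [left; by rewrite pmulr_rlt0|right].
by rewrite mulrC -ltr_pdivrMr// div1r.
Qed.

Lemma eta_test j y : test_function (fun z => eta j (y - z)).
Proof.
have key (t : R) : eta j (y - t) != 0 -> t \in `[y - j.+1%:R^-1, y].
  move=> ht; rewrite in_itv/=; apply/andP; split; rewrite leNgt; apply: contra ht => h.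
  - by apply/eqP; apply: eta_supp0; right; rewrite ltrBrDr -ltrBrDl.
  - by apply/eqP; apply: eta_supp0; left; rewrite subr_lt0.
split; first by move=> n x; rewrite eta_bsum; exact: bsum_smooth.
apply: (@subclosed_compact _ _ `[y - j.+1%:R^-1, y]).
- exact: closed_closure.
- exact: segment_compact.
- rewrite closureE => z; apply; split; first exact: interval_closed.
  by move=> t /= ht; exact: key.
Qed.

Lemma derive1_shift (f : R -> R) (y z : R) : (forall x, derivable f x 1) ->
  derive1 (fun z => f (z - y)) z = derive1 f (z - y).
Proof.
move=> hf.
have h1 : is_derive (z - y) 1 f (derive1 f (z - y)) by rewrite derive1E; exact: derivableP.
have h2 : is_derive z 1 (fun x : R => x - y) 1.
  have h := is_deriveB (is_derive_id z 1) (is_derive_cst y z 1).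
  by apply: is_derive_eq h _; rewrite subr0.
have [_ e] := @is_derive1_comp R f (fun x : R => x - y) z _ _ h1 h2.
by rewrite mulr1 in e; rewrite derive1E.
Qed.

(** The kernels for different y are translates of each other, so the derivative bound found at y = 0
    serves for all. *)
Lemma eta_C1c j : exists C, forall y, C1c (fun z => eta j (y - z)) (y - j.+1%:R^-1) y C.
Proof.
have [a [b [C [_ _ _ C0 hC]]]] := test_function_C1c (eta_test j 0).
have d0 y x : derivable (fun z => eta j (y - z)) x 1 by have [h _] := eta_test j y; exact: (h 0%N).
exists C => y; have [hd _] := eta_test j y.
have shE : (fun z => eta j (y - z)) = (fun z => (fun z => eta j (0 - z)) (z - y)).
  by apply/funext => z; congr (eta j _); ring.
have dE z : derive1 (fun z => eta j (y - z)) z = derive1 (fun z => eta j (0 - z)) (z - y).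
  by rewrite shE (@derive1_shift (fun z => eta j (0 - z))).
have z0 z : z < y - j.+1%:R^-1 \/ y < z -> eta j (y - z) = 0.
  move=> hz; apply: eta_supp0; case: hz => hz.
  - by right; rewrite ltrBrDr -ltrBrDl.
  - by left; rewrite subr_lt0.
split; [exact: d0| | |exact: C0|].
- by move=> x; apply: derivable_continuous; exact: (hd 1%N).
- move=> z hz; split; first exact: z0.
  case: hz => hz.
  + by apply: (@derive1_eq0 _ _ [set t | t < y - j.+1%:R^-1]); [exact: open_lt|exact: hz|move=> t ht; apply: z0; left].
  + by apply: (@derive1_eq0 _ _ [set t | y < t]); [exact: open_gt|exact: hz|move=> t ht; apply: z0; right].
- by move=> z; rewrite dE.
Qed.

Lemma mollifier_eta : mollifier eta Keta.
Proof.
move=> j; have N0 := npsi_gt0 j; split.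
- by move=> t; rewrite mulr_ge0 ?invr_ge0 ?psi_ge0// ltW.
- move=> t; rewrite /eta -[leRHS]mulr1; apply: ler_pM.
  + by rewrite invr_ge0 ltW.
  + exact: psi_ge0.
  + have e0 : 0 < expR (- 4) * expR (- 4) :> R by rewrite mulr_gt0 ?expR_gt0.
    have j0 : 0 < j.+1%:R :> R by [].
    have q0 : 0 < expR (- 4) * expR (- 4) / (2 * j.+1%:R) :> R.
      by rewrite divr_gt0// mulr_gt0.
    have h : (npsi j)^-1 <= (expR (- 4) * expR (- 4) / (2 * j.+1%:R))^-1.
      by rewrite lef_pV2 ?posrE//; exact: npsi_lb.
    apply: le_trans h _.
    rewrite le_eqVlt; apply/orP; left; apply/eqP; rewrite /Keta.
    move: (j.+1%:R : R) j0 (expR (- 4) : R) (@expR_gt0 R (- 4)) => J j0' x x0; field.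
    by rewrite !gt_eqF.
  + exact: psi_le1.
- exact: eta_supp0.
- by rewrite /eta (RiZ _ (ib_psi j)) mulVf// gt_eqF.
- have [C hC] := eta_C1c j; exists C => y; split; [exact: hC|exact: eta_test].
Qed.

End Bump.

(** * Weak derivatives in either direction against the Gagliardo integral *)

Lemma tilde_H_weakP (R : realType) (alpha s : R) (u : R -> R) :
  0 < alpha -> alpha < 1 -> s = 1 \/ s = -1 ->
  (sqint u /\ exists v, sqint v /\ forall phi, test_function phi ->
     Ri (fun x => v x * phi x) = Ri (fun x => u x * fd alpha s phi x)) <->
  tilde_H alpha u.
Proof.
move=> a0 a1 hs; split=> [[hu [v [hv hw]]]|].
- apply/tilde_HP; split=> //.
  exact: (Gagliardo_of_weak a0 a1 (@mollifier_eta R) hs hu hv hw).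
- move=> /tilde_HP[hu hW]; split=> //.
  have [v [hv hw]] := weak_of_Gagliardo a0 a1 hs hu hW.
  exists v; split=> // phi /test_function_C1c[a [b [C hn]]].
  exact: hw hn.
Qed.

Theorem theorem5p18 (R : realType) (alpha : R)
    (alpha_gt0 : 0 < alpha) (alpha_lt1 : alpha < 1) :
  left_H alpha = tilde_H alpha /\ right_H alpha = tilde_H alpha.
Proof.
split; apply/seteqP; split=> u.
- move=> [/L2P hu [v [[_ hw] /L2P hv]]].
  (* Here s = 1: the left weak derivative is tested against the right derivative of phi. *)
  apply/(tilde_H_weakP u alpha_gt0 alpha_lt1 (or_introl erefl)); split=> //.
  exists v; split=> // phi hphi; have [a [b [C hn]]] := test_function_C1c hphi.
  by rewrite !RiE (hw _ hphi) (right_fracderivE alpha_lt1 hn).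
- move=> /(tilde_H_weakP u alpha_gt0 alpha_lt1 (or_introl erefl))[hu [v [hv hw]]].
  split; first exact/L2P.
  exists v; split; last exact/L2P.
  split; first exact: sqint_locally_integrable.
  move=> phi hphi; have [a [b [C hn]]] := test_function_C1c hphi.
  by have := hw _ hphi; rewrite !RiE (right_fracderivE alpha_lt1 hn).
- move=> [/L2P hu [v [[_ hw] /L2P hv]]].
  (* Here s = -1: the right weak derivative is tested against the left derivative of phi. *)
  apply/(tilde_H_weakP u alpha_gt0 alpha_lt1 (or_intror erefl)); split=> //.
  exists v; split=> // phi hphi; have [a [b [C hn]]] := test_function_C1c hphi.
  by rewrite !RiE (hw _ hphi) (left_fracderivE alpha_lt1 hn).
- move=> /(tilde_H_weakP u alpha_gt0 alpha_lt1 (or_intror erefl))[hu [v [hv hw]]].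
  split; first exact/L2P.
  exists v; split; last exact/L2P.
  split; first exact: sqint_locally_integrable.
  move=> phi hphi; have [a [b [C hn]]] := test_function_C1c hphi.
  by have := hw _ hphi; rewrite !RiE (left_fracderivE alpha_lt1 hn).
Qed.
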